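(* Let $X(\ell_2)$ be the real Banach space $\{f\in C[0,1] : f|_\Delta\in E\}$, where $E\subseteq C(\Delta)$ is an isometric copy of the real Hilbert space $\ell_2$ (see context). Then $\mathrm{Iso}(X(\ell_2))$ does not contain any non-trivial uniformly continuous one-parameter subgroup, while $\mathrm{Iso}(X(\ell_2)^* )$ contains infinitely many different uniformly continuous one-parameter subgroups. Equivalently, $\mathcal{T}(\mathrm{Iso}(X(\ell_2)),\mathrm{Id})=\{0\}$, but $\mathcal{T}(\mathrm{Iso}(X(\ell_2)^* ),\mathrm{Id})$ is infinite-dimensional.
   Context: Construction of $X(E)$: let $\Delta\subset[0,1]$ be the Cantor middle third set. A separable Banach space $E$ is identified, through some fixed linear isometric embedding (which exists by the Banach–Mazur theorem), with a closed subspace of $C(\Delta)$. Then $X(E)=\{f\in C[0,1] : f|_\Delta\in E\}$, with the supremum norm. Here all scalars are real and $E=\ell_2$ (real, separable, infinite-dimensional Hilbert space). For a Banach space $Z$, $L(Z)$ is the Banach algebra of bounded linear operators on $Z$, $\mathrm{Id}$ is the identity operator, $Z^*$ is the dual space, and $\mathrm{Iso}(Z)$ is the group of all surjective linear isometries of $Z$. A uniformly continuous one-parameter subgroup of $\mathrm{Iso}(Z)$ is a group of the form $\{\exp(\rho T) : \rho\in\mathbb{R}\}$ for some $T\in L(Z)$ which is contained in $\mathrm{Iso}(Z)$, where $\exp(T)=\sum_{n=0}^\infty T^n/n!$; it is non-trivial if $T\neq 0$. The tangent space of $\mathrm{Iso}(Z)$ at $\mathrm{Id}$ is $$\mathcal{T}(\mathrm{Iso}(Z),\mathrm{Id})=\{f'(0)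 : f:[-1,1]\to \mathrm{Iso}(Z),\ f(0)=\mathrm{Id},\ f \text{ differentiable at } 0\},$$ where differentiability is with respect to the operator norm of $L(Z)$. *)

(* Defs.v *)
From HB Require Import structures.
From mathcomp Require Import all_boot all_order all_algebra.
From mathcomp Require Import all_classical all_reals all_analysis.
From mathcomp Require Import ring lra.

Set Implicit Arguments.
Unset Strict Implicit.
Unset Printing Implicit Defensive.

Import Order.TTheory GRing.Theory Num.Theory.
Import numFieldNormedType.Exports.

Local Open Scope classical_set_scope.
Local Open Scope ring_scope.

Section SupNorm.
Context (R : realType) (T : Type) (W : normedModType R).
Implicit Types (A : set T) (f g : T -> W).

Definition bounded_over A f := exists M : R, forall x, A x -> `|f x| <= M.

(* On the empty set, and for unbounded f, the value is 0. *)
Definition supnorm A f : R := sup [set `|f x| | x in A].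

Lemma supnorm_ub A f x : bounded_over A f -> A x -> `|f x| <= supnorm A f.
Proof.
move=> [M fM] Ax; apply: ub_le_sup; last by exists x.
by exists M => _ [y Ay <-]; exact: fM.
Qed.

Lemma supnorm_le A f M :
  0 <= M -> (forall x, A x -> `|f x| <= M) -> supnorm A f <= M.
Proof.
move=> M0 fM; have [->|/set0P[x Ax]] := eqVneq A set0.
  by rewrite /supnorm image_set0 sup0.
apply: ge_sup; first by exists `|f x|, x.
by move=> _ [y Ay <-]; exact: fM.
Qed.

Lemma supnorm_ge0 A f : bounded_over A f -> 0 <= supnorm A f.
Proof.
move=> bf; have [->|/set0P[x Ax]] := eqVneq A set0.
  by rewrite /supnorm image_set0 sup0.
exact: le_trans (normr_ge0 _) (supnorm_ub bf Ax).
Qed.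

Lemma bounded_overD A f g :
  bounded_over A f -> bounded_over A g -> bounded_over A (f + g).
Proof.
move=> [M fM] [N gN]; exists (M + N) => x Ax.
by rewrite (le_trans (ler_normD _ _))// lerD// ?fM ?gN.
Qed.

Lemma bounded_overZ A (k : R) f : bounded_over A f -> bounded_over A (k *: f).
Proof.
move=> [M fM]; exists (`|k| * M) => x Ax.
by rewrite normrZ ler_wpM2l// fM.
Qed.

Lemma supnormD A f g : bounded_over A f -> bounded_over A g ->
  supnorm A (f + g) <= supnorm A f + supnorm A g.
Proof.
move=> bf bg; apply: supnorm_le; first by rewrite addr_ge0// supnorm_ge0.
move=> x Ax; rewrite (le_trans (ler_normD _ _))// lerD//; exact: supnorm_ub.
Qed.

Lemma supnormZ A (k : R) f : bounded_over A f ->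
  supnorm A (k *: f) = `|k| * supnorm A f.
Proof.
move=> bf; have le (l : R) h : bounded_over A h ->
    supnorm A (l *: h) <= `|l| * supnorm A h.
  move=> bh; apply: supnorm_le; first by rewrite mulr_ge0// supnorm_ge0.
  by move=> x Ax; rewrite normrZ ler_wpM2l// supnorm_ub.
apply/eqP; rewrite eq_le le//=.
have [->|k0] := eqVneq k 0.
  by rewrite normr0 mul0r supnorm_ge0//; exact: bounded_overZ.
rewrite -ler_pdivlMl ?normr_gt0//.
have {1}-> : f = k^-1 *: (k *: f) by rewrite scalerA mulVf// scale1r.
by rewrite (le_trans (le _ _ _))// ?normfV//; exact: bounded_overZ.
Qed.

End SupNorm.

Section BoundedOperators.
Context (R : realType) (V W : normedModType R).

Definition bounded_linear : {pred V -> W} :=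
  mem [set f : V -> W |
    linear f /\ exists M : R, forall x, `|f x| <= M * `|x|].

Record boundedOp := BoundedOp {
  op_fun :> V -> W;
  op_funP : op_fun \in bounded_linear }.

HB.instance Definition _ := [isSub for op_fun].
HB.instance Definition _ := [Choice of boundedOp by <:].

Lemma bounded_linear_submod : submod_closed bounded_linear.
Proof.
split=> [|k f g]; rewrite !inE/=.
  by split=> [a x y /=|]; [rewrite scaler0 addr0
    | exists 0 => x; rewrite mul0r normr0].
move=> [lf [M fM]] [lg [N gN]]; split=> [a x y|].
  rewrite -![(_ *: _ + _ : _ -> _) _]/(k *: f _ + g _) lf lg.
  by rewrite !scalerDr !scalerA (mulrC k) -!addrA; congr (_ + _); rewrite addrCA.
exists (`|k| * M + N) => x; rewrite (le_trans (ler_normD _ _))// mulrDl lerD//.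
by rewrite normrZ -mulrA ler_wpM2l.
Qed.

HB.instance Definition _ :=
  GRing.isSubmodClosed.Build _ _ bounded_linear bounded_linear_submod.
HB.instance Definition _ := [SubChoice_isSubLmodule of boundedOp by <:].

Lemma op_linear (f : boundedOp) : linear f.
Proof. by have := op_funP f; rewrite inE => -[]. Qed.

HB.instance Definition _ (f : boundedOp) :=
  GRing.isLinear.Build R V W *:%R (op_fun f) (op_linear f).

Definition unit_ball : set V := [set x | `|x| <= 1].

Lemma op_bounded (f : boundedOp) : bounded_over unit_ball f.
Proof.
have := op_funP f; rewrite inE => -[_ [M fM]]; exists `|M| => x /= x1.
rewrite (le_trans (fM x))// (le_trans (ler_norm _))// normrM normr_id.
by rewrite ler_piMr.
Qed.

Definition opnorm (f : boundedOp) : R := supnorm unit_ball f.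

Lemma opnormD (f g : boundedOp) : opnorm (f + g) <= opnorm f + opnorm g.
Proof. by apply: supnormD; exact: op_bounded. Qed.

Lemma opnormZ (k : R) (f : boundedOp) : opnorm (k *: f) = `|k| * opnorm f.
Proof. by apply: supnormZ; exact: op_bounded. Qed.

Lemma opnorm_eq0 (f : boundedOp) : opnorm f = 0 -> f = 0.
Proof.
move=> f0; apply/val_inj/funext => x /=.
have [->|x0] := eqVneq x 0; first exact: linear0.
have ux : unit_ball (`|x|^-1 *: x).
  by rewrite /unit_ball/= normrZ normfV normr_id mulVf ?normr_eq0.
have := supnorm_ub (op_bounded f) ux; rewrite [leRHS]f0 normr_le0 linearZ/=.
by rewrite scaler_eq0 invr_eq0 normr_eq0 (negbTE x0)/= => /eqP.
Qed.

HB.instance Definition _ :=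
  @Lmodule_isNormed.Build R boundedOp opnorm opnormD opnormZ opnorm_eq0.

End BoundedOperators.

Section OperatorAlgebra.
Context (R : realType) (Z : normedModType R).
Local Notation LZ := (boundedOp Z Z).

Lemma op_id_subproof : @idfun Z \in @bounded_linear R Z Z.
Proof. by rewrite inE; split=> //; exists 1 => x; rewrite mul1r. Qed.

Lemma op_comp_subproof (S T : LZ) : S \o T \in @bounded_linear R Z Z.
Proof.
have := op_funP S; have := op_funP T; rewrite !inE.
move=> [lT [M TM]] [lS [N SN]]; split=> [a x y|]; first by rewrite /= lT lS.
exists (`|N| * M) => x /=; rewrite (le_trans (SN _))//.
by rewrite (le_trans (ler_wpM2r _ (ler_norm _)))// -mulrA ler_wpM2l.
Qed.

Definition op_id : LZ := BoundedOp op_id_subproof.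
Definition op_comp (S T : LZ) : LZ := BoundedOp (op_comp_subproof S T).

Let op_compA : associative op_comp.
Proof. by move=> S T U; exact/val_inj. Qed.
Let op_comp1l : left_id op_id op_comp.
Proof. by move=> S; exact/val_inj. Qed.
Let op_comp1r : right_id op_id op_comp.
Proof. by move=> S; exact/val_inj. Qed.
Let op_compDl : left_distributive op_comp +%R.
Proof. by move=> S T U; exact/val_inj. Qed.
Let op_compDr : right_distributive op_comp +%R.
Proof. by move=> S T U; apply/val_inj/funext => x /=; rewrite linearD. Qed.

HB.instance Definition _ := GRing.Zmodule_isPzRing.Build LZ
  op_compA op_comp1l op_comp1r op_compDl op_compDr.

(* The series converges when Z is complete; elsewhere limn is a default. *)
Definition op_exp (T : LZ) : LZ :=
  limn (series (fun n => (n`!%:R : R)^-1 *: T ^+ n)).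

Definition Iso : set LZ :=
  [set T | (forall z, `|T z| = `|z|) /\ (forall w, exists z, T z = w)].

Definition one_parameter_group (T : LZ) : set LZ :=
  range (fun rho : R => op_exp (rho *: T)).

(* A subgroup is a set of operators: two generators T with the same
   exp(R T) give the same subgroup. *)
Definition one_parameter_subgroups : set (set LZ) :=
  [set G | G `<=` Iso /\ exists T, G = one_parameter_group T].

(* The curve is a function on R of which only the values on [-1, 1], a
   neighbourhood of 0, matter. *)
Definition tangent_Iso : set LZ :=
  [set T | exists f : R -> LZ,
    [/\ forall t, -1 <= t <= 1 -> Iso (f t), f 0 = 1 &
        is_derive (0 : R) (1 : R) f T]].

End OperatorAlgebra.

Definition dual (R : realType) (Z : normedModType R) : normedModType R :=
  boundedOp Z R.

Definition finite_span (R : realType) (V : lmodType R) n (v : 'I_n -> V)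
    : set V :=
  [set x | exists c : 'I_n -> R, x = \sum_(i < n) c i *: v i].

(* S is a linear subspace which no finite family spans. *)
Definition infinite_dimensional (R : realType) (V : lmodType R) (S : set V) :=
  submod_closed (mem S) /\
  forall n (v : 'I_n -> V), ~ S `<=` finite_span v.

Definition continuous_pred (R : realType) (K : topologicalType)
    : {pred K -> R} := mem [set f : K -> R | continuous f].

(* The compactness proof is a parameter so that the supremum norm below is a
   norm on the whole type. *)
Record contFun (R : realType) (K : topologicalType) (cK : compact [set: K]) :=
  ContFun { cf_fun :> K -> R; cf_funP : cf_fun \in @continuous_pred R K }.

Section ContinuousFunctions.
Context (R : realType) (K : topologicalType) (cK : compact [set: K]).
Local Notation CK := (contFun R cK).

HB.instance Definition _ := [isSub for @cf_fun R K cK].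
HB.instance Definition _ := [Choice of CK by <:].

Lemma continuous_submod : submod_closed (@continuous_pred R K).
Proof.
split=> [|k f g]; rewrite !inE/=; first by move=> x; exact: cvg_cst.
by move=> cf cg x; apply: cvgD; [apply: cvgZl_tmp; exact: cf|exact: cg].
Qed.

HB.instance Definition _ :=
  GRing.isSubmodClosed.Build _ _ (@continuous_pred R K) continuous_submod.
HB.instance Definition _ := [SubChoice_isSubLmodule of CK by <:].

Lemma cf_continuous (f : CK) : continuous f.
Proof. by have := cf_funP f; rewrite inE. Qed.

Lemma cf_bounded (f : CK) : bounded_over [set: K] f.
Proof.
have /compact_bounded : compact (f @` [set: K]).
  apply: continuous_compact => //; apply: continuous_subspaceT.
  exact: cf_continuous.
by move=> [M [_ /(_ (M + 1))]] fM; exists (M + 1) => x _; apply: fM;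
  [rewrite ltrDl|exists x].
Qed.

Definition cf_norm (f : CK) : R := supnorm [set: K] f.

Lemma cf_normD (f g : CK) : cf_norm (f + g) <= cf_norm f + cf_norm g.
Proof. by apply: supnormD; exact: cf_bounded. Qed.

Lemma cf_normZ (k : R) (f : CK) : cf_norm (k *: f) = `|k| * cf_norm f.
Proof. by apply: supnormZ; exact: cf_bounded. Qed.

Lemma cf_norm_eq0 (f : CK) : cf_norm f = 0 -> f = 0.
Proof.
move=> f0; apply/val_inj/funext => x /=; apply/eqP; rewrite -normr_le0.
by rewrite -[leRHS]f0; apply: supnorm_ub => //; exact: cf_bounded.
Qed.

HB.instance Definition _ :=
  @Lmodule_isNormed.Build R CK cf_norm cf_normD cf_normZ cf_norm_eq0.

End ContinuousFunctions.

Lemma compact_set_type (T : topologicalType) (A : set T) :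
  compact A -> compact [set: set_type A].
Proof.
move=> cA F PF _.
have [|p [Ap clp]] := cA (set_val @ F) _ _.
  by apply: (@filterS _ F _ setT); [move=> x _; exact: set_valP|exact: filterT].
exists (SigSub (mem_set Ap)); split=> // B C FB [_ [[U oU <-]] Up UC].
have FBU : (set_val @ F) (set_val @` B).
  by apply: (@filterS _ F _ B _ _ FB) => x Bx; exists x.
have [_ [[b Bb <-] Ub]] := clp _ _ FBU (open_nbhs_nbhs (conj oU Up)).
by exists b; split=> //; exact: UC.
Qed.

Section Cantor.
Context (R : realType).

Definition I01 : set R := `[0, 1].

Fixpoint cantor_step (n : nat) : set R :=
  if n is n'.+1 then
    [set x / 3 | x in cantor_step n'] `|` [set (x + 2) / 3 | x in cantor_step n']
  else I01.

Lemma I01_compact : compact I01.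
Proof. exact: segment_compact. Qed.

Definition cantor_set : set R := \bigcap_n cantor_step n.

Lemma cantor_sub : cantor_set `<=` I01.
Proof. by move=> x /(_ 0 I). Qed.

Lemma cantor_stepS n x :
  cantor_step n.+1 x <-> cantor_step n (3 * x) \/ cantor_step n (3 * x - 2).
Proof.
split=> [[[y yn <-]|[y yn <-]]|[xn|xn]].
- by left; rewrite mulrC divfK.
- by right; rewrite mulrC divfK// addrK.
- by left; exists (3 * x) => //; field.
- by right; exists (3 * x - 2) => //; field.
Qed.

Lemma cantor_step_closed n : closed (cantor_step n).
Proof.
elim: n => [|n IH]; first exact: interval_closed.
have -> : cantor_step n.+1 = (fun x => 3 * x) @^-1` cantor_step n `|`
                             (fun x => 3 * x - 2) @^-1` cantor_step n.
  by apply/seteqP; split=> x /cantor_stepS.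
apply: closedU; apply: preimage_closed => //.
  by move=> x _; exact: mulrl_continuous.
by move=> x _; apply: cvgB; [exact: mulrl_continuous|exact: cvg_cst].
Qed.

Lemma cantor_compact : compact cantor_set.
Proof.
apply: (subclosed_compact _ (@segment_compact R 0 1) cantor_sub).
by apply: closed_bigI => n _; exact: cantor_step_closed.
Qed.

End Cantor.
Arguments I01 R : clear implicits.
Arguments cantor_set R : clear implicits.

Definition l2_pred (R : realType) : {pred nat -> R} :=
  mem [set u : nat -> R | cvgn (series (fun n => u n ^+ 2))].

Record l2 (R : realType) := L2 {
  l2_fun :> nat -> R;
  l2_funP : l2_fun \in @l2_pred R }.

Section L2.
Context (R : realType).

HB.instance Definition _ := [isSub for @l2_fun R].
HB.instance Definition _ := [Choice of l2 R by <:].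

Lemma l2_submod : submod_closed (@l2_pred R).
Proof.
split=> [|k u v]; rewrite !inE/=.
  have -> : series (fun n => (0 : nat -> R) n ^+ 2) = cst 0.
    by apply/funext => n; rewrite /series/= big1// => i _; rewrite expr0n.
  exact: is_cvg_cst.
move=> cu cv; pose w n := (2 * k ^+ 2) *: u n ^+ 2 + 2 *: v n ^+ 2.
apply: (@series_le_cvg _ _ w) => [n|n|n|]; first exact: sqr_ge0.
- by rewrite addr_ge0// mulr_ge0 ?sqr_ge0// mulr_ge0 ?sqr_ge0.
- rewrite -[(_ *: _ + _ : _ -> _) n]/(k * u n + v n) /w /GRing.scale/=.
  have := sqr_ge0 (k * u n - v n); nra.
- by apply: is_cvg_seriesD; exact: is_cvg_seriesZ.
Qed.

HB.instance Definition _ :=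
  GRing.isSubmodClosed.Build _ _ (@l2_pred R) l2_submod.
HB.instance Definition _ := [SubChoice_isSubLmodule of l2 R by <:].

Definition l2_sqnorm (u : l2 R) : R := limn (series (fun n => u n ^+ 2)).
Definition l2_norm (u : l2 R) : R := Num.sqrt (l2_sqnorm u).

Lemma l2_cvg (u : l2 R) : cvgn (series (fun n => u n ^+ 2)).
Proof. by have := l2_funP u; rewrite inE. Qed.

Lemma l2_partial_le (u : l2 R) n :
  series (fun n => u n ^+ 2) n <= l2_sqnorm u.
Proof.
apply: nondecreasing_cvgn_le; last exact: l2_cvg.
by apply: nondecreasing_series => i _; rewrite sqr_ge0.
Qed.

Lemma l2_sqnorm_ge0 (u : l2 R) : 0 <= l2_sqnorm u.
Proof. by have := l2_partial_le u 0; rewrite /series/= big_geq. Qed.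

Lemma l2_norm_eq0 (u : l2 R) : l2_norm u = 0 -> u = 0.
Proof.
move=> /eqP; rewrite sqrtr_eq0 => u0; apply/val_inj/funext => n /=.
apply/eqP; rewrite -sqrf_eq0 eq_le sqr_ge0 andbT (le_trans _ u0)//.
rewrite (le_trans _ (l2_partial_le u n.+1))// /series/= big_nat_recr//=.
by rewrite lerDr sumr_ge0// => i _; rewrite sqr_ge0.
Qed.

Lemma l2_normZ (k : R) (u : l2 R) : l2_norm (k *: u) = `|k| * l2_norm u.
Proof.
rewrite /l2_norm -sqrtr_sqr -sqrtrM ?sqr_ge0//; congr Num.sqrt.
rewrite /l2_sqnorm -[RHS](lim_seriesZ _ (@l2_cvg u)); congr (limn (series _)).
by apply/funext => n; rewrite /= exprMn.
Qed.

Lemma l2_normD (u v : l2 R) : l2_norm (u + v) <= l2_norm u + l2_norm v.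
Proof.
have [/l2_norm_eq0 ->|u0] := eqVneq (l2_norm u) 0.
  by rewrite add0r lerDr sqrtr_ge0.
have [/l2_norm_eq0 ->|v0] := eqVneq (l2_norm v) 0.
  by rewrite addr0 lerDl sqrtr_ge0.
set a := l2_norm u in u0 *; set b := l2_norm v in v0 *.
have a0 : 0 < a by rewrite lt_neqAle eq_sym u0 sqrtr_ge0.
have b0 : 0 < b by rewrite lt_neqAle eq_sym v0 sqrtr_ge0.
have ua : l2_sqnorm u = a ^+ 2 by rewrite sqr_sqrtr// l2_sqnorm_ge0.
have vb : l2_sqnorm v = b ^+ 2 by rewrite sqr_sqrtr// l2_sqnorm_ge0.
rewrite -[leRHS]ger0_norm ?addr_ge0 ?sqrtr_ge0// -sqrtr_sqr; apply: ler_wsqrtr.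
have -> : (a + b) ^+ 2 = (1 + b / a) *: l2_sqnorm u + (1 + a / b) *: l2_sqnorm v.
  by rewrite ua vb /GRing.scale/=; field; rewrite u0 v0.
rewrite /l2_sqnorm -!(lim_seriesZ _ (@l2_cvg _)) -lim_seriesD; last 2 first.
- by apply: is_cvg_seriesZ; exact: l2_cvg.
- by apply: is_cvg_seriesZ; exact: l2_cvg.
apply: lim_series_le; first exact: l2_cvg.
  by apply: is_cvg_seriesD; apply: is_cvg_seriesZ; exact: l2_cvg.
move=> n; rewrite -[leLHS]/((u n + v n) ^+ 2).
rewrite -[leRHS]/((1 + b / a) * u n ^+ 2 + (1 + a / b) * v n ^+ 2).
rewrite -subr_ge0.
have -> : (1 + b / a) * u n ^+ 2 + (1 + a / b) * v n ^+ 2 - (u n + v n) ^+ 2 =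
    (b * u n - a * v n) ^+ 2 / (a * b) by field; rewrite u0 v0.
by rewrite divr_ge0 ?sqr_ge0// mulr_ge0// ltW.
Qed.

HB.instance Definition _ :=
  @Lmodule_isNormed.Build R (l2 R) l2_norm l2_normD l2_normZ l2_norm_eq0.

End L2.

Section XSpace.
Context (R : realType).

Definition C01 : normedModType R := contFun R (compact_set_type (@I01_compact R)).
Definition CDelta : normedModType R :=
  contFun R (compact_set_type (@cantor_compact R)).

Lemma restrict_subproof (f : C01) :
  (f : I01 R -> R) \o subfun (@cantor_sub R) \in
    @continuous_pred R (cantor_set R).
Proof.
rewrite inE/= => x; apply: continuous_comp; last exact: cf_continuous.
apply: (continuous_comp_initial (w := set_val)).
exact: initial_continuous.
Qed.

Definition restrict (f : C01) : CDelta := ContFun _ (restrict_subproof f).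

Lemma restrict_linear : linear restrict.
Proof. by move=> k f g; apply/val_inj. Qed.

HB.instance Definition _ :=
  GRing.isLinear.Build R C01 CDelta *:%R restrict restrict_linear.

(* E is given by an embedding j into C(Delta), of which only the range is
   used; [range j v] says that v belongs to the range of j. *)
Section Embedding.
Context (E : normedModType R) (j : {linear E -> CDelta}).

Definition X_pred : {pred C01} := mem [set f : C01 | range j (restrict f)].

Record Xspace := XSpace { X_fun :> C01; X_funP : X_fun \in X_pred }.

HB.instance Definition _ := [isSub for X_fun].
HB.instance Definition _ := [Choice of Xspace by <:].

Lemma X_submod : submod_closed X_pred.
Proof.
split=> [|k f g]; rewrite !inE/=; first by exists 0; rewrite // !linear0.
by move=> [x _ xf] [y _ yg]; exists (k *: x + y); rewrite // !linearP xf yg.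
Qed.

HB.instance Definition _ := GRing.isSubmodClosed.Build _ _ X_pred X_submod.
HB.instance Definition _ := [SubChoice_isSubLmodule of Xspace by <:].

Definition X_norm (f : Xspace) : R := `|X_fun f|.

Lemma X_normD (f g : Xspace) : X_norm (f + g) <= X_norm f + X_norm g.
Proof. exact: ler_normD. Qed.

Lemma X_normZ (k : R) (f : Xspace) : X_norm (k *: f) = `|k| * X_norm f.
Proof. exact: normrZ. Qed.

Lemma X_norm_eq0 (f : Xspace) : X_norm f = 0 -> f = 0.
Proof. by move=> /normr0_eq0 f0; exact/val_inj. Qed.

HB.instance Definition _ :=
  @Lmodule_isNormed.Build R Xspace X_norm X_normD X_normZ X_norm_eq0.

End Embedding.
End XSpace.

(* Main.v *)
(** Tangent vectors of Iso(X) at Id vanish because X = X(E) has many peaking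
    functions.  If f attains its norm at x, then (T f)(x) = 0 for every tangent
    vector T.  Near a point y outside the Cantor set Delta every f can be
    modified freely within X, so f is the sum of a function with a factor
    vanishing at y, a multiple of a bump peaking at y, and a small error; hence
    (T f)(y) = 0, and T = 0 because the complement of Delta is dense.

    In the dual, let b_n be continuous functions with values in [0, 1], equal to
    1 on Delta and tending to 0 off Delta.  Then W mu (f) = lim mu(b_n f)
    (a generalized limit) depends only on the restriction of f to Delta, and W
    is the L-projection of X^* onto E^*: since (1 - b_n) f + b_n g is a convex
    combination at each point, mu - W mu + W mu o C has norm at most |mu| for
    every contraction C of E = l2.  So the plane rotations of l2 extend to X^*; their
    generators T satisfy T^3 = -T, which makes exp(rho T) equal to
    1 + sin rho T + (1 - cos rho) T^2. *)

Require Import Defs.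
From HB Require Import structures.
From mathcomp Require Import all_boot all_order all_algebra.
From mathcomp Require Import all_classical all_reals all_analysis.
From mathcomp Require Import ring lra.

Import Order.TTheory GRing.Theory Num.Theory.
Import numFieldNormedType.Exports.

Local Open Scope classical_set_scope.
Local Open Scope ring_scope.

Set Implicit Arguments.
Unset Strict Implicit.
Unset Printing Implicit Defensive.

(** * Operators, isometries and tangent vectors *)

(** The product rule at the identity: two first-order errors and a cross term of second order.
    Factors keep their order because it is applied to operators. *)
Lemma mul_sub1_linear (A : pzRingType) (p q s t : A) :
  p * q - 1 - (s + t) = (p - 1 - s) * q + s * (q - 1) + (q - 1 - t).
Proof.
rewrite mulrBr mulr1 !mulrBl mul1r (addrA _ (s * q)) subrK.
rewrite [_ - q - s]addrAC -(addrA q) (addrA _ q) subrK opprD.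
by rewrite addrACA.
Qed.

Section OperatorNorm.
Context (R : realType) (V W : normedModType R).
Implicit Types (S T : boundedOp V W).

Lemma opD S T x : (S + T) x = S x + T x. Proof. by []. Qed.
Lemma opN T x : (- T) x = - T x. Proof. by []. Qed.
Lemma opZ (k : R) T x : (k *: T) x = k *: T x. Proof. by []. Qed.

Lemma opP S T : (forall x, S x = T x) -> S = T.
Proof. by move=> ST; apply/val_inj/funext. Qed.

Lemma op_le T x : `|T x| <= `|T| * `|x|.
Proof.
have [->|x0] := eqVneq x 0; first by rewrite linear0 !normr0 mulr0.
have ux : unit_ball (`|x|^-1 *: x).
  by rewrite /unit_ball/= normrZ normfV normr_id mulVf ?normr_eq0.
have := supnorm_ub (op_bounded T) ux.
rewrite linearZ/= normrZ normfV normr_id ler_pdivrMl ?normr_gt0//.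
by rewrite mulrC.
Qed.

Lemma op_norm_le T M :
  0 <= M -> (forall x, `|T x| <= M * `|x|) -> `|T| <= M.
Proof.
move=> M0 TM; apply: supnorm_le => // x x1.
by rewrite (le_trans (TM x))// ler_piMr.
Qed.

Lemma bounded_linear_intro (f : V -> W) M :
  linear f -> (forall x, `|f x| <= M * `|x|) -> f \in @bounded_linear R V W.
Proof. by move=> lf fM; rewrite inE; split=> //; exists M. Qed.

End OperatorNorm.

Section OperatorAlgebraNorm.
Context (R : realType) (Z : normedModType R).
Implicit Types (S T : boundedOp Z Z).

Lemma opM S T x : (S * T) x = S (T x). Proof. by []. Qed.
Lemma op1 x : (1 : boundedOp Z Z) x = x. Proof. by []. Qed.

Lemma op_scaleAl (k : R) S T : k *: S * T = k *: (S * T).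
Proof. exact/opP. Qed.

Lemma op_scaleAr (k : R) S T : S * (k *: T) = k *: (S * T).
Proof. by apply/opP => x; rewrite opM !opZ linearZ. Qed.

Lemma op_scaleX (k : R) T n : (k *: T) ^+ n = k ^+ n *: T ^+ n.
Proof.
elim: n => [|n IH]; first by rewrite !expr0 scale1r.
by rewrite !exprS IH op_scaleAl op_scaleAr scalerA.
Qed.

Lemma op_normM S T : `|S * T| <= `|S| * `|T|.
Proof.
apply: op_norm_le => [|x]; first by rewrite mulr_ge0.
by rewrite opM (le_trans (op_le S _))// -mulrA ler_wpM2l// op_le.
Qed.

Lemma op_norm1 : `|1 : boundedOp Z Z| <= 1.
Proof. by apply: op_norm_le => // x; rewrite mul1r. Qed.

Lemma op_normX T n : `|T ^+ n| <= `|T| ^+ n.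
Proof.
elim: n => [|n IH]; first by rewrite !expr0 op_norm1.
by rewrite !exprS (le_trans (op_normM _ _))// ler_wpM2l.
Qed.

End OperatorAlgebraNorm.

(** * Derivatives at 0 and the tangent space as a linear space *)

Lemma is_derive0P (R : realType) (V : normedModType R) (f : R -> V) (T : V) :
  is_derive (0 : R) (1 : R) f T <->
  forall e : R, 0 < e -> exists2 d : R, 0 < d &
    forall h : R, `|h| < d -> `|f h - f 0 - h *: T| <= e * `|h|.
Proof.
have quotE h : h != 0 -> `|T - h^-1 *: (f (h *: (1 : R) + 0) - f 0)| =
    `|f h - f 0 - h *: T| / `|h|.
  move=> h0; rewrite addr0 [h *: 1]mulr1 mulrC -normfV -normrZ distrC.
  by rewrite [in RHS]scalerBr scalerA mulVf// scale1r.
have cvgE : (fun h => h^-1 *: (f (h *: (1 : R) + 0) - f 0)) @ 0^' --> T <->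
  forall e : R, 0 < e -> exists2 d : R, 0 < d &
    forall h : R, `|h| < d -> `|f h - f 0 - h *: T| <= e * `|h|.
  split=> [/cvgrPdist_le cT e e0|eT].
    have [d /= d0 dT] := cT _ e0; exists d => // h hd.
    have [->|h0] := eqVneq h 0; first by rewrite subrr scale0r subr0 !normr0 mulr0.
    have := dT h; rewrite /ball_/= sub0r normrN quotE// => /(_ hd h0).
    by rewrite ler_pdivrMr ?normr_gt0.
  apply/cvgrPdist_le => e e0; have [d d0 dT] := eT _ e0.
  exists d => //= h; rewrite /ball_/= sub0r normrN => hd h0.
  by rewrite quotE// ler_pdivrMr ?normr_gt0// dT.
rewrite -cvgE; split=> [[df <-]//|fT]; split; first by apply/cvg_ex; exists T.
exact: cvg_lim fT.
Qed.

Section Tangent.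
Context (R : realType) (Z : normedModType R).
Implicit Types (S T : boundedOp Z Z).

Lemma Iso1 : Iso (1 : boundedOp Z Z).
Proof. by split=> // w; exists w. Qed.

Lemma IsoM S T : Iso S -> Iso T -> Iso (S * T).
Proof.
move=> [iS sS] [iT sT]; split=> [z|w]; first by rewrite opM iS iT.
by have [z <-] := sS w; have [y <-] := sT z; exists y.
Qed.

Lemma Iso_contraction S T : (forall z, `|S z| <= `|z|) ->
  (forall z, `|T z| <= `|z|) -> S * T = 1 -> T * S = 1 -> Iso S.
Proof.
move=> cS cT ST TS; split=> [z|w].
  by apply/eqP; rewrite eq_le cS/= -{1}[z]op1 -TS opM cT.
by exists (T w); rewrite -opM ST.
Qed.

Lemma op_norm_Iso T : Iso T -> `|T| <= 1.
Proof. by move=> [iT _]; apply: op_norm_le => // x; rewrite iT mul1r. Qed.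

(** If [f] and [g] are curves of isometries with derivatives [S] and [T], then [f (a * t) * g t] has
    derivative [a *: S + T] by the product rule. *)
Lemma tangent_Iso_submod : submod_closed (mem (@tangent_Iso R Z)).
Proof.
split=> [|a S T]; rewrite !inE.
  by exists (cst 1); split; [move=> t _; exact: Iso1| |exact: is_derive_cst].
move=> [f [fI f0 /is_derive0P df]] [g [gI g0 /is_derive0P dg]].
(* [f (a * t)] is known to be an isometry only for [|a * t| <= 1]; replacing it by the identity
   elsewhere leaves the curve unchanged near 0. *)
pose f' t := if `|a * t| <= 1 then f (a * t) else 1.
exists (fun t => f' t * g t).
have f'0 : f' 0 = 1 by rewrite /f' mulr0 normr0 ler01 f0.
have fI' t : Iso (f' t).
  by rewrite /f'; case: ifPn => [|_]; [rewrite ler_norml => /fI|exact: Iso1].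
split=> [t t1||]; first by apply: IsoM => //; exact: gI.
  by rewrite f'0 g0 mulr1.
apply/is_derive0P => e e0.
pose c := `|a| + 1; pose e1 := e / (c + 2).
have c0 : 0 < c by rewrite ltr_wpDl.
have e10 : 0 < e1 by rewrite divr_gt0// addr_gt0.
have [d1 d10 df1] := df _ e10; have [d2 d20 dg2] := dg _ e10.
(* The cross term is at most [|a *: S| * (|T| + e1) * |h| ^ 2], hence at most [e1 * |h|] once
   [|h| <= e1 / B]; the added 1 keeps [B] positive. *)
pose B := `|a *: S| * (`|T| + e1) + 1.
have B0 : 0 < B by rewrite ltr_wpDl// mulr_ge0// addr_ge0// ltW.
exists (Num.min (Num.min (d1 / c) d2) (Num.min c^-1 (e1 / B))) => [|h].
  by rewrite !lt_min d20 invr_gt0 c0 !andbT/= (divr_gt0 d10 c0) divr_gt0.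
rewrite !lt_min => /andP[/andP[hd1 hd2] /andP[h1 hB]].
have ah x : `|h| < x / c -> `|a * h| < x.
  rewrite ltr_pdivlMr// => /(le_lt_trans _); apply.
  by rewrite normrM mulrC ler_wpM2l// /c lerDl.
have -> : f' h = f (a * h) by rewrite /f' ltW// ah// mul1r.
rewrite f'0 g0 mulr1.
have F := df1 _ (ah _ hd1); have G := dg2 _ hd2.
rewrite f0 in F; rewrite g0 in G.
have h1' : `|h| <= 1.
  by rewrite (le_trans (ltW h1))// invf_le1// /c lerDr.
have gh1 : `|g h| <= 1 by apply/op_norm_Iso/gI; rewrite -ler_norml.
have -> : f (a * h) * g h - 1 - h *: (a *: S + T) =
    (f (a * h) - 1 - (a * h) *: S) * g h + (a * h) *: S * (g h - 1) +
    (g h - 1 - h *: T).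
  by rewrite -mul_sub1_linear scalerDr scalerA (mulrC h).
have g1 : `|g h - 1| <= (`|T| + e1) * `|h|.
  rewrite -[g h - 1](subrK (h *: T)) (le_trans (ler_normD _ _))//.
  by rewrite mulrDl addrC lerD// normrZ mulrC.
have t1 : `|(f (a * h) - 1 - (a * h) *: S) * g h| <= e1 * `|a| * `|h|.
  rewrite (le_trans (op_normM _ _))// (le_trans (ler_piMr _ gh1))//.
  by rewrite -mulrA -normrM.
have t2 : `|(a * h) *: S * (g h - 1)| <= e1 * `|h|.
  rewrite (le_trans (op_normM _ _))// (mulrC a) -scalerA [leLHS]mulrC normrZ.
  have hB' : `|h| * B <= e1 by rewrite -ler_pdivlMr// ltW.
  rewrite mulrCA [leRHS]mulrC ler_wpM2l// (le_trans _ hB')//.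
  rewrite (le_trans (ler_wpM2r _ g1))// [leLHS]mulrC mulrA mulrC ler_wpM2l//.
  by rewrite /B lerDl.
rewrite (le_trans (ler_normD _ _))//.
have -> : e = e1 * (`|a| + 1) + e1 + e1 .
  by rewrite /e1 /c; field; rewrite gt_eqF// addr_gt0.
rewrite !mulrDl lerD// (le_trans (ler_normD _ _))// lerD//.
rewrite (le_trans t1)//.
by rewrite ler_wpM2r// ler_wpM2l ?(ltW e10)// lerDl.
Qed.

End Tangent.

(** * One-parameter groups and their generators *)

Section Exponential.
Context (R : realType) (Z : normedModType R).
Implicit Types (S T : boundedOp Z Z).

Definition exp_term T (n : nat) : boundedOp Z Z := (n`!%:R : R)^-1 *: T ^+ n.

(** For [|rho| <= 1] and [i >= 2] one has [|rho| ^ i <= rho ^ 2], so the tail is dominated by the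
    real exponential series at [|T|]. The bound is uniform in [n] and so passes to the limit. *)
Lemma exp_terms_remainder T (rho : R) n : `|rho| <= 1 ->
  `|series (exp_term (rho *: T)) n.+2 - 1 - rho *: T|
    <= rho ^+ 2 * expR `|T|.
Proof.
move=> rho1; rewrite /series/= 2?big_ltn//=.
rewrite {1 2}/exp_term expr0 !factS fact0 expr1 invr1 !scale1r.
rewrite [1 + _]addrC addrK [_ *: T + _]addrC addrK.
apply: (le_trans (ler_norm_sum _ _ _)).
apply: (@le_trans _ _ (\sum_(2 <= i < n.+2) rho ^+ 2 * exp_coeff `|T| i)).
  apply: ler_sum_nat => i /andP[i2 _].
  rewrite /exp_term op_scaleX scalerA normrZ normrM normfV normr_nat /exp_coeff/=.
  rewrite mulrAC mulrC mulrA -mulrA.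
  apply: ler_pM; rewrite ?invr_ge0//.
    rewrite normrX -(subnK i2) exprD -[leRHS]mul1r -(ger0_norm (sqr_ge0 rho)).
    by rewrite normrX ler_wpM2r// exprn_ile1.
  by rewrite mulrC ler_wpM2r// ?invr_ge0// op_normX.
rewrite -mulr_sumr ler_wpM2l ?sqr_ge0//.
apply: (@le_trans _ _ (series (exp_coeff `|T|) n.+2)).
  rewrite /series/= [leRHS](@big_cat_nat _ _ _ 2)//= lerDr sumr_ge0// => i _.
  by rewrite /exp_coeff/= divr_ge0// exprn_ge0.
apply: (nondecreasing_cvgn_le _ (@is_cvg_series_exp_coeff _ _)) => /=.
  by apply: nondecreasing_series => i _ _; rewrite /exp_coeff/= divr_ge0//
    exprn_ge0.
Qed.

(* A nonconvergent exponential series would have limit 0 by default, and 0 is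
   not an isometry. *)
Lemma tangent_one_parameter_group T : (exists z : Z, z != 0) ->
  one_parameter_group T `<=` @Iso R Z -> tangent_Iso T.
Proof.
move=> [z z0] GI.
have eI (rho : R) : Iso (op_exp (rho *: T)) by apply: GI; exists rho.
have eT (rho : R) : `|rho| <= 1 ->
    `|op_exp (rho *: T) - 1 - rho *: T| <= rho ^+ 2 * expR `|T|.
  move=> rho1; set M := rho ^+ 2 * _.
  have cS : cvgn (series (exp_term (rho *: T))).
    apply: contrapT => /dvgP S0.
    have := (eI rho).1 z; rewrite /op_exp [limn _]S0 normr0 => /esym/eqP.
    by rewrite normr_eq0 (negbTE z0).
  have bE S : (`|S - 1 - rho *: T| <= M) = (`|1 + rho *: T - S| <= M).
    by rewrite -addrA -opprD distrC.
  (* All partial sums from index 2 on lie in one closed ball, so their limit does too. *)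
  rewrite bE; have cl := @closed_closed_ball_ R _ (1 + rho *: T) M.
  apply: (closed_cvg _ cl _ _ cS).
  exists 2%N => // -[|[|n]]// _.
  have := exp_terms_remainder T n rho1; rewrite bE; exact.
exists (fun rho => op_exp (rho *: T)).
have e0 : op_exp ((0 : R) *: T) = 1.
  apply/eqP; rewrite -subr_eq0 -normr_le0.
  have := eT 0; rewrite normr0 ler01 => /(_ isT).
  by rewrite {2}scale0r subr0 expr0n mul0r.
split=> //; apply/is_derive0P => e epos.
exists (Num.min 1 (e / expR `|T|)) => [|h].
  by rewrite lt_min ltr01 divr_gt0 ?expR_gt0.
rewrite lt_min => /andP[h1]; rewrite ltr_pdivlMr ?expR_gt0// => he.
rewrite e0 (le_trans (eT _ (ltW h1)))// -real_normK ?num_real//.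
rewrite expr2 -mulrA mulrC.
by rewrite ler_wpM2r// ltW.
Qed.

End Exponential.

(** * The Cantor set *)

Lemma continuous_max0 (R : realType) (T : topologicalType) (g : T -> R) :
  continuous g -> continuous (fun y => Num.max 0 (g y) : R).
Proof.
move=> cg x; apply: (@continuous_max R T (cst 0 : T -> R^o) (g : T -> R^o) x).
  exact: cvg_cst.
exact: cg.
Qed.

Lemma continuous_I01 (R : realType) (h : R -> R) :
  continuous h -> continuous (h \o set_val : I01 R -> R).
Proof.
move=> ch x; apply: continuous_comp; last exact: ch.
exact: initial_continuous.
Qed.

Section CantorSet.
Context (R : realType).
Implicit Types (x y : R).

Lemma cantor_step_bounds n x : cantor_step n x -> 0 <= x <= 1.
Proof.
elim: n x => [|n IH] x; first by rewrite /= /I01/= in_itv.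
by move=> /cantor_stepS [/IH|/IH]; lra.
Qed.

(** A segment inside step [n.+1] misses 1/2, so it lies in the left or the right third; magnifying
    that third by 3 reduces to step [n]. *)
Lemma cantor_step_interval n (a b : R) : a <= b ->
  (forall x, a <= x <= b -> cantor_step n x) -> b - a <= 3^-1 ^+ n.
Proof.
elim: n a b => [|n IH] a b ab abn.
  have /abn/cantor_step_bounds : a <= a <= b by rewrite lexx.
  have /abn/cantor_step_bounds : a <= b <= b by rewrite lexx ab.
  by rewrite expr0; lra.
have third x : cantor_step n.+1 x ->
    cantor_step n (3 * x) /\ x <= 3^-1 \/ cantor_step n (3 * x - 2) /\ 2 / 3 <= x.
  move=> /cantor_stepS [] xn; [left|right]; split=> //;
    have := cantor_step_bounds xn; lra.
have n12 : ~ cantor_step n.+1 (2^-1 : R) by move=> /third; lra.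
have n12ab : ~ (a <= 2^-1 <= b) by move=> /abn.
have /third a3 : cantor_step n.+1 a by apply: abn; rewrite lexx.
have /third b3 : cantor_step n.+1 b by apply: abn; rewrite lexx ab.
rewrite exprS.
have [[[_ a3'] [_ b3']]|[[_ a3'] [_ b3']]] :
    (cantor_step n (3 * a) /\ a <= 3^-1) /\ (cantor_step n (3 * b) /\ b <= 3^-1) \/
    (cantor_step n (3 * a - 2) /\ 2 / 3 <= a) /\
    (cantor_step n (3 * b - 2) /\ 2 / 3 <= b).
- case: a3 b3 => -[? ?] [] [? ?]; [by left| | |by right].
    by case: n12ab; lra.
  by lra.
- suff : 3 * b - 3 * a <= 3^-1 ^+ n by lra.
  apply: IH => [|x axb]; first lra.
  have /third : cantor_step n.+1 (x / 3) by apply: abn; lra.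
  by rewrite mulrC divfK// => -[[]//|[_]]; lra.
- suff : (3 * b - 2) - (3 * a - 2) <= 3^-1 ^+ n by lra.
  apply: IH => [|x axb]; first lra.
  have /third : cantor_step n.+1 ((x + 2) / 3) by apply: abn; lra.
  by rewrite mulrC divfK// addrK => -[[_]|[]//]; lra.
Qed.

(** Otherwise a segment of positive length would lie in every step, although segments in step [n]
    have length at most [3^-1 ^+ n]. *)
Lemma cantor_complement_dense (x : R) e : 0 <= x <= 1 -> 0 < e ->
  exists y, [/\ 0 <= y <= 1, `|x - y| < e & ~ cantor_set R y].
Proof.
move=> x01 e0; apply: contrapT => nex.
have xeC y : 0 <= y <= 1 -> `|x - y| < e -> cantor_set R y.
  by move=> y01 xy; apply: contrapT => Cy; apply: nex; exists y.
pose a := Num.max 0 (x - e / 2); pose b := Num.min 1 (x + e / 2).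
have [a0 a1 a2] : [/\ 0 <= a, x - e / 2 <= a & a < b].
  split; rewrite /a /b ?le_max ?lexx ?orbT// gt_max !lt_min.
  by do !(apply/andP; split); lra.
have [b1 b2] : b <= 1 /\ b <= x + e / 2.
  by rewrite /b !ge_min !lexx orbT.
have ba0 : 0 < b - a by lra.
have /cvgrPdist_lt/(_ _ ba0)[n _ /(_ n (leqnn n))] :
    (fun n => 3^-1 ^+ n) @ \oo --> (0 : R).
  by apply: cvg_expr; rewrite ger0_norm; lra.
rewrite /= sub0r normrN ger0_norm ?exprn_ge0// => n3.
suff : b - a <= 3^-1 ^+ n by lra.
apply: cantor_step_interval => [|y /andP[ay yb]]; first exact: ltW.
by apply: (xeC y) => //; [|rewrite ltr_norml]; lra.
Qed.

Definition cantor_dist x : R := inf [set `|x - y| | y in cantor_set R].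

Lemma cantor_set0 : cantor_set R 0.
Proof.
move=> n _; elim: n => [|n IH]; first by rewrite /= /I01/= in_itv/= lexx ler01.
by apply/cantor_stepS; left; rewrite mulr0.
Qed.

Let dists x := [set `|x - y| | y in cantor_set R].

Let dists_has_inf x : has_inf (dists x).
Proof.
split; first by exists `|x - 0|, 0 => //; exact: cantor_set0.
by exists 0 => _ [y _ <-].
Qed.

Lemma cantor_dist_le x y : cantor_set R y -> cantor_dist x <= `|x - y|.
Proof. by move=> Cy; apply: ge_inf; [exact: (dists_has_inf x).2|exists y]. Qed.

Lemma cantor_dist_ge0 x : 0 <= cantor_dist x.
Proof.
by apply: lb_le_inf => [|_ [y _ <-]//]; exact: (dists_has_inf x).1.
Qed.

Lemma cantor_dist_lipschitz x y : `|cantor_dist x - cantor_dist y| <= `|x - y|.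
Proof.
suff H u v : cantor_dist u - cantor_dist v <= `|u - v|.
  by rewrite ler_norml H andbT lerNl opprB distrC H.
rewrite lerBlDr -lerBlDl; apply: lb_le_inf; first exact: (dists_has_inf v).1.
move=> _ [z Cz <-]; rewrite lerBlDl (le_trans (cantor_dist_le u Cz))//.
by rewrite -(subrKA v) ler_normD.
Qed.

Lemma cantor_dist_continuous : continuous cantor_dist.
Proof.
move=> x; apply/cvgrPdist_lt => e e0; exists e => //= y xy.
exact: le_lt_trans (cantor_dist_lipschitz x y) xy.
Qed.

Lemma cantor_dist_eq0 x : cantor_set R x -> cantor_dist x = 0.
Proof.
move=> Cx; apply/eqP; rewrite eq_le cantor_dist_ge0 andbT.
by rewrite (le_trans (cantor_dist_le x Cx))// subrr normr0.
Qed.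

Lemma cantor_closed : closed (cantor_set R).
Proof. by apply: compact_closed; [exact: Rhausdorff|exact: cantor_compact]. Qed.

Lemma cantor_dist_gt0 x : ~ cantor_set R x -> 0 < cantor_dist x.
Proof.
move=> nCx; have /open_nbhs_nbhs : open_nbhs x (~` cantor_set R).
  by split=> //; exact: closed_openC cantor_closed.
move=> [e /= e0 xe]; apply: (lt_le_trans e0).
apply: lb_le_inf => [|_ [y Cy <-]]; first exact: (dists_has_inf x).1.
by rewrite leNgt; apply/negP => xy; exact: (xe y).
Qed.

End CantorSet.

(** * The space X(E) *)

Section XspaceTools.
Context (R : realType) (j : {linear l2 R -> CDelta R}).
Hypothesis j_isometry : forall u : l2 R, `|j u| = `|u|.
Local Notation X := (Xspace j).
Local Notation incl := (subfun (@cantor_sub R)).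
Implicit Types (f g : X) (u v : l2 R) (x : I01 R) (d : cantor_set R).

Definition X_eval f x : R := cf_fun (X_fun f) x.

Lemma X_eval_continuous f : continuous (X_eval f).
Proof. exact: cf_continuous. Qed.

Lemma X_evalP f g : X_eval f =1 X_eval g -> f = g.
Proof. by move=> fg; apply/val_inj/val_inj/funext. Qed.

Lemma X_evalL (k : R) f g x :
  X_eval (k *: f + g) x = k * X_eval f x + X_eval g x.
Proof. by []. Qed.

Lemma X_evalD f g x : X_eval (f + g) x = X_eval f x + X_eval g x.
Proof. by []. Qed.

Lemma X_evalZ (k : R) f x : X_eval (k *: f) x = k * X_eval f x.
Proof. by []. Qed.

Lemma X_evalB f g x : X_eval (f - g) x = X_eval f x - X_eval g x.
Proof. by []. Qed.

Lemma X_eval_le f x : `|X_eval f x| <= `|f|.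
Proof. by apply: supnorm_ub => //; exact: cf_bounded. Qed.

Lemma CDelta_le (w : CDelta R) d : `|w d| <= `|w|.
Proof. by apply: supnorm_ub => //; exact: cf_bounded. Qed.

Lemma X_norm_le f M : 0 <= M -> (forall x, `|X_eval f x| <= M) -> `|f| <= M.
Proof. by move=> M0 fM; apply: supnorm_le => // x _; exact: fM. Qed.

Lemma X_intro_subproof (h : I01 R -> R) : continuous h ->
  h \in @continuous_pred R (I01 R).
Proof. by rewrite inE. Qed.

Definition X_intro_cf (h : I01 R -> R) (ch : continuous h) : C01 R :=
  ContFun _ (X_intro_subproof ch).

Lemma X_intro_pred (h : I01 R -> R) (ch : continuous h) u :
  (forall d, h (incl d) = j u d) -> X_intro_cf ch \in X_pred j.
Proof.
by move=> hu; rewrite inE; exists u => //; apply/val_inj/funext => d; rewrite /= hu.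
Qed.

Definition X_intro (h : I01 R -> R) (ch : continuous h) u
  (hu : forall d, h (incl d) = j u d) : X := XSpace (X_intro_pred ch hu).

(** The restriction to the Cantor set is recorded as a vector of l2, so that coordinates and
    operators of l2 apply to it; since [j] is injective, the choice is unique. *)
Definition X_trace f : l2 R := projT1 (cid2 (set_mem (X_funP f))).

Lemma X_traceE f d : X_eval f (incl d) = j (X_trace f) d.
Proof. by rewrite /X_trace; case: cid2 => u /= _ ->. Qed.

Lemma X_trace_eq f u : (forall d, X_eval f (incl d) = j u d) -> X_trace f = u.
Proof.
move=> fu; apply/eqP; rewrite -subr_eq0 -normr_eq0 -j_isometry linearB normr_eq0.
by rewrite subr_eq0; apply/eqP/val_inj/funext => d; rewrite /= -X_traceE fu.
Qed.

Lemma X_trace_linear : linear X_trace.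
Proof.
move=> k f g; apply: X_trace_eq => d; rewrite X_evalL !X_traceE.
by rewrite [in RHS]linearP.
Qed.

HB.instance Definition _ :=
  GRing.isLinear.Build R X (l2 R) *:%R X_trace X_trace_linear.

Lemma X_trace_le f : `|X_trace f| <= `|f|.
Proof.
rewrite -j_isometry; apply: supnorm_le => // d _.
by rewrite -X_traceE X_eval_le.
Qed.

(** Tietze extension of [j u] from the closed Cantor set with the same bound. The vector 0 is set
    apart because the extension theorem is applied with a positive bound. *)
Lemma X_extension u : exists f, X_trace f = u /\ `|f| <= `|u|.
Proof.
have [->|u0] := eqVneq u 0; first by exists 0; rewrite linear0 !normr0.
pose h (t : R) : R := if pselect (cantor_set R t) is left Ct
  then j u (SigSub (mem_set Ct)) else 0.
have hE d : h (val d) = j u d.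
  rewrite /h; case: pselect => [Ct|]; last by have := set_valP d.
  by congr (j u _); exact/val_inj.
have ch : {within cantor_set R, continuous h}.
  apply/subspace_sigL_continuousP; rewrite (_ : sigL _ _ = j u).
    exact: cf_continuous.
  by apply/funext => d; rewrite /sigL/= hE.
have hM t : cantor_set R t -> `|h t| <= `|u|.
  move=> Ct; rewrite /h; case: pselect => // {}Ct; rewrite -j_isometry.
  exact: CDelta_le.
have u_gt0 : 0 < `|u| by rewrite normr_gt0.
have [g [gh cg gM]] := continuous_bounded_extension
  pseudometric_normal (@cantor_closed R) u_gt0 ch hM.
have cg' := continuous_I01 cg.
have gu d : (g \o set_val) (incl d) = j u d.
  by rewrite -hE; apply/esym/gh/mem_set; exact: set_valP.
exists (X_intro cg' gu); split; first exact: X_trace_eq.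
by apply: X_norm_le => // x; exact: gM.
Qed.

(** A mere choice of extension, with no linearity in [u]; linearity returns whenever the quantity at
    hand depends only on the trace. *)
Definition X_ext u : X := projT1 (cid (X_extension u)).

Lemma X_extK u : X_trace (X_ext u) = u.
Proof. by rewrite /X_ext; case: cid => f []. Qed.

Lemma X_ext_le u : `|X_ext u| <= `|u|.
Proof. by rewrite /X_ext; case: cid => f []. Qed.

Section Multiplication.
Variables (a : I01 R -> R) (ca : continuous a) (c : R).
Hypothesis ac : forall d, a (incl d) = c.

Let mul_continuous f : continuous (fun x => a x * X_eval f x).
Proof. by move=> x; exact: (cvgM (@ca x) (@X_eval_continuous f x)). Qed.

Let mul_trace f d : a (incl d) * X_eval f (incl d) = j (c *: X_trace f) d.
Proof. by rewrite ac X_traceE linearZ. Qed.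

(** Multiplying by a continuous function that is constant on the Cantor set only rescales the trace,
    so the product stays in X. *)
Definition X_mul f : X := X_intro (@mul_continuous f) (mul_trace f).

Lemma X_mulE f x : X_eval (X_mul f) x = a x * X_eval f x.
Proof. by []. Qed.

Lemma X_trace_mul f : X_trace (X_mul f) = c *: X_trace f.
Proof. by apply: X_trace_eq => d; rewrite X_mulE -mul_trace. Qed.

End Multiplication.

End XspaceTools.

(** * Vanishing of the tangent space of Iso(X) *)

Section TangentXspace.
Context (R : realType) (j : {linear l2 R -> CDelta R}).
Local Notation X := (Xspace j).
Implicit Types (T : boundedOp X X) (f g : X) (x y t : I01 R) (e : R).

Lemma X_eval_unif f x e : 0 < e -> exists2 r : R, 0 < r &
  forall t, `|val x - val t| < r -> `|X_eval f x - X_eval f t| < e.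
Proof.
move=> e0; have /cvgrPdist_lt/(_ _ e0) := @X_eval_continuous R j f x.
move=> [_ [[U oU <-] Ux UC]].
have [r /= r0 xr] : nbhs (val x) U by exact: open_nbhs_nbhs.
by exists r => // t xt; apply/UC/xr.
Qed.

Lemma normr_le_eps_eq0 (a M : R) :
  (forall e, 0 < e -> `|a| <= e * M) -> a = 0.
Proof.
move=> aM; apply/eqP; rewrite -normr_le0.
apply/ler_addgt0Pl => e e0; have M1 : 0 < `|M| + 1 by rewrite ltr_wpDl.
rewrite addr0 (le_trans (aM (e / (`|M| + 1)) _)) ?divr_gt0//.
rewrite -mulrA ler_piMr ?(ltW e0)// mulrC ler_pdivrMr// mul1r.
by rewrite (le_trans (ler_norm M))// lerDl.
Qed.

(* At a norming point [x] of [f] the curve h |-> (F h f)(x) has a maximum at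
   0, so its derivative (T f)(x) vanishes. *)
Lemma tangent_norming_point T f x :
  tangent_Iso T -> X_eval f x = `|f| -> X_eval (T f) x = 0.
Proof.
move=> [F [FI F0 /is_derive0P dF]] fx; apply: (@normr_le_eps_eq0 _ `|f|) => e e0.
have [r r0 dr] := dF _ e0.
pose h := Num.min (r / 2) 1.
have h0 : 0 < h by rewrite lt_min ltr01 divr_gt0.
have hr : h < r by rewrite gt_min ltr_pdivrMr// mulr_natr mulr2n ltrDl r0.
have h1 : h <= 1 by rewrite ge_min lexx orbT.
(* Used for [s = h] and [s = - h]: as [F s f] cannot exceed [|f|] at [x], both signs bound the
   derivative from one side each. *)
have le s : `|s| = h -> s * X_eval (T f) x <= h * (e * `|f|).
  move=> sh; have := dr s; rewrite F0 sh => /(_ hr) Fs.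
  have Fsf : `|X_eval (F s f) x| <= `|f|.
    rewrite (le_trans (X_eval_le _ _))// (FI _ _).1//.
    by rewrite -ler_norml sh.
  have : `|X_eval ((F s - 1 - s *: T) f) x| <= h * (e * `|f|).
    rewrite (le_trans (X_eval_le _ _))// (le_trans (op_le _ _))//.
    by rewrite mulrCA mulrA ler_wpM2r.
  have -> : X_eval ((F s - 1 - s *: T) f) x =
    X_eval (F s f) x - X_eval f x - s * X_eval (T f) x.
    by rewrite opD opN opZ X_evalB X_evalZ opD opN op1 X_evalB.
  rewrite fx => /ler_normlP[]; move: Fsf => /(le_trans (ler_norm _)); lra.
rewrite -(ler_pM2l h0) -[X in X * _ <= _](gtr0_norm h0) -normrM.
rewrite ler_norml le ?gtr0_norm// andbT lerNl -mulNr le//.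
by rewrite normrN gtr0_norm.
Qed.

Lemma tangent_off_cantor T f y :
  tangent_Iso T -> ~ cantor_set R (val y) -> X_eval (T f) y = 0.
Proof.
move=> TT Cy; apply: (@normr_le_eps_eq0 _ `|T|) => e e0.
have [r1 r10 fr] := X_eval_unif f y e0.
have d0 := cantor_dist_gt0 Cy.
(* Within [r1] of [y] the function [f] varies by less than [e]; the distance to the Cantor set keeps
   the tent [p] zero there. *)
pose r := Num.min r1 (cantor_dist (val y)).
have r0 : 0 < r by rewrite lt_min r10.
pose p (t : R) : R := Num.max 0 (1 - `|val y - t| / r).
have p01 (t : R) : 0 <= p t <= 1.
  by rewrite le_max lexx ge_max ler01/= gerBl divr_ge0// ltW.
have cp : continuous p.
  apply: continuous_max0 => t.
  apply: cvgB; first exact: cvg_cst.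
  apply: cvgMr_tmp; apply: cvg_norm.
  by apply: cvgB; [exact: cvg_cst|exact: cvg_id].
have p_far (t : R) : r <= `|val y - t| -> p t = 0.
  by move=> rt; apply/max_idPl; rewrite subr_le0 ler_pdivlMr// mul1r.
have pC (d : cantor_set R) : p (val (subfun (@cantor_sub R) d)) = 0.
  apply: p_far; rewrite (le_trans _ (cantor_dist_le (val y) (set_valP d)))//.
  by rewrite /r ge_min lexx orbT.
have py : p (val y) = 1 by rewrite /p subrr normr0 mul0r subr0 max_r.
have cq := continuous_I01 cp.
have pC0 d : (p \o val) (subfun (@cantor_sub R) d) = j 0 d by rewrite /= pC linear0.
pose pc : R -> R := fun u => 1 - p u.
have cp1 : continuous pc.
  by move=> u; apply: cvgB; [exact: cvg_cst|exact: cp].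
have cq1 := continuous_I01 cp1.
have qC d : (pc \o val) (subfun (@cantor_sub R) d) = 1.
  by rewrite /pc /= pC subr0.
pose bump : X := X_intro cq pC0.
pose g := X_mul cq1 qC f.
have bE x : X_eval bump x = p (val x) by [].
have gE x : X_eval g x = (1 - p (val x)) * X_eval f x by [].
have nb : `|bump| = 1.
  apply/le_anti/andP; split.
    by apply: X_norm_le => // x; rewrite bE; case/andP: (p01 (val x)) => *;
      rewrite ger0_norm.
  by rewrite -py -bE (le_trans (ler_norm _))// X_eval_le.
have Tb : X_eval (T bump) y = 0.
  by apply: tangent_norming_point => //; rewrite nb bE py.
(* Pointwise this is a convex combination of [f] and the constant [|f|], equal to [|f|] at [y]. So
   [y] is a norming point of the sum as well as of [bump]. *)
have ng : `|g + `|f| *: bump| = `|f|.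
  have gb x : X_eval (g + `|f| *: bump) x =
    (1 - p (val x)) * X_eval f x + `|f| * p (val x).
    by rewrite X_evalD X_evalZ gE bE.
  apply/eqP; rewrite eq_le; apply/andP; split.
    apply: X_norm_le => // x; rewrite gb; have /andP[p0 pc1] := p01 (val x).
    rewrite (le_trans (ler_normD _ _))// !normrM normr_id (ger0_norm p0).
    rewrite ger0_norm ?subr_ge0//.
    have : (1 - p (val x)) * `|X_eval f x| <= (1 - p (val x)) * `|f|.
      by rewrite ler_wpM2l ?subr_ge0// X_eval_le.
    lra.
  rewrite (le_trans _ (X_eval_le _ y))// gb py subrr mul0r add0r mulr1.
  by rewrite ler_norm.
have Tg : X_eval (T g) y = 0.
  have : X_eval (T (g + `|f| *: bump)) y = 0.
    apply: tangent_norming_point => //; rewrite ng.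
    by rewrite X_evalD X_evalZ gE bE py subrr mul0r add0r mulr1.
  by rewrite linearD linearZ X_evalD X_evalZ Tb mulr0 addr0.
pose q := f - g - X_eval f y *: bump.
(* The remainder is [- p * (f y - f)]: it lives where [p] is nonzero, and there [f] is [e]-close to
   [f y]. *)
have nq : `|q| <= e.
  apply: X_norm_le => [|x]; first exact: ltW.
  have -> : X_eval q x = - p (val x) * (X_eval f y - X_eval f x).
    by rewrite !X_evalB X_evalZ gE bE; ring.
  have [rx|xr] := leP r `|val y - val x|.
    by rewrite p_far// oppr0 mul0r normr0 ltW.
  have /andP[pge ple] := p01 (val x).
  rewrite normrM normrN (ger0_norm pge) (le_trans (ler_piMl _ ple))// ltW// fr//.
  by rewrite (lt_le_trans xr)// ge_min lexx.
have -> : X_eval (T f) y = X_eval (T q) y.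
  by rewrite /q !linearB linearZ !X_evalB X_evalZ Tg Tb mulr0 !subr0.
rewrite (le_trans (X_eval_le _ _))// (le_trans (op_le _ _))// mulrC.
by rewrite ler_wpM2r.
Qed.

Lemma tangent_Iso_Xspace_eq0 T : tangent_Iso T -> T = 0.
Proof.
move=> TT; apply: opP => f; apply: X_evalP => x.
rewrite -[RHS]/(0 : R); apply/eqP/negPn/negP => Tfx.
have /(X_eval_unif (T f) x)[r r0 xr] : 0 < `|X_eval (T f) x| by rewrite normr_gt0.
have x01 : 0 <= val x <= 1 by have := set_valP x; rewrite /I01/= in_itv.
have [y [y01 xy Cy]] := cantor_complement_dense x01 r0.
have yI : I01 R y by rewrite /I01/= in_itv.
have := xr (SigSub (mem_set yI)) xy.
by rewrite (@tangent_off_cantor T f (SigSub (mem_set yI)) TT Cy) subr0 ltxx.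
Qed.

End TangentXspace.

(** * Exponentials of operators with [T ^+ 3 = - T] *)

Section RotationExponential.
Context (R : realType) (Z : normedModType R) (T : boundedOp Z Z).
Hypothesis T3 : T ^+ 3 = - T.
Implicit Types (x y rho : R).

(** As [T ^+ 3 = - T], products of these combinations follow complex multiplication, with [comb x y]
    in the role of the number [- y + i x]. *)
Let comb x y : boundedOp Z Z := x *: T + y *: T ^+ 2.

Let combD x y x' y' : comb x y + comb x' y' = comb (x + x') (y + y').
Proof. by rewrite /comb !scalerDl addrACA. Qed.

Let T_comb x y : T * comb x y = comb (- y) x.
Proof.
by rewrite /comb mulrDr !op_scaleAr -expr2 -exprS T3 scalerN scaleNr addrC.
Qed.

Let combM x y x' y' :
  comb x y * comb x' y' = comb (- (x * y' + y * x')) (x * x' - y * y').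
Proof.
have combZ k u v : k *: comb u v = comb (k * u) (k * v).
  by rewrite /comb scalerDr !scalerA.
rewrite {1}/comb mulrDl !op_scaleAl expr2 -mulrA !T_comb !combZ combD.
by congr comb; ring.
Qed.

(** Rodrigues' formula: the identity on the kernel of [T], and [cos rho + sin rho T] on its range,
    where [T ^+ 2] is minus the identity. *)
Definition op_rotation rho : boundedOp Z Z :=
  1 + (sin rho *: T + (1 - cos rho) *: T ^+ 2).

Lemma op_rotationE rho z : op_rotation rho z =
  z + (sin rho *: T z + (1 - cos rho) *: (T ^+ 2) z).
Proof. by rewrite /op_rotation opD op1 opD !opZ. Qed.

Lemma op_rotationVK rho : op_rotation rho * op_rotation (- rho) = 1.
Proof.
rewrite /op_rotation sinN cosN -[_ + _ *: T ^+ 2]/(comb _ _).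
rewrite -[X in _ * (1 + X)]/(comb _ _).
rewrite mulrDl mul1r mulrDr mulr1 combM combD -addrA combD.
have sc := cos2Dsin2 rho.
set x := (X in comb X _); have -> : x = 0 by rewrite /x; ring.
set y := comb _ _; have -> : y = comb 0 0.
  congr comb; transitivity (1 - (cos rho ^+ 2 + sin rho ^+ 2)); first by ring.
  by rewrite sc subrr.
by rewrite /comb !scale0r !addr0.
Qed.

(** Indices start at 1: at 0 the right side would be [- T ^+ 2] instead of 1. This discrepancy is
    the constant [1 + T ^+ 2] in the partial sums of [op_exp_rotation]. *)
Lemma exp_term_rotation rho n :
  exp_term (rho *: T) n.+1 =
  sin_coeff rho n.+1 *: T - cos_coeff rho n.+1 *: T ^+ 2.
Proof.
have Todd m : T ^+ m.*2.+1 = (-1) ^+ m *: T.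
  elim: m => [|m IH]; first by rewrite expr0 scale1r expr1.
  rewrite doubleS exprS exprS IH 2!op_scaleAr.
  rewrite mulrA -expr2 -exprSr T3 exprS mulN1r scaleNr scalerN.
  by [].
have Teven m : T ^+ m.+1.*2 = (-1) ^+ m *: T ^+ 2.
  by rewrite doubleS exprSr Todd op_scaleAl expr2.
rewrite /exp_term op_scaleX scalerA -[n]odd_double_half; case: (odd n) => /=.
  rewrite add1n -doubleS -cos_coeff'E Teven sin_coeff_even scale0r sub0r -scaleNr.
  by rewrite scalerA; congr (_ *: _); rewrite /cos_coeff' -exprnP exprS; ring.
rewrite add0n -sin_coeff'E Todd cos_coeff_odd scale0r subr0 scalerA.
by congr (_ *: _); rewrite /sin_coeff' -exprnP; ring.
Qed.

Lemma op_exp_rotation rho : op_exp (rho *: T) = op_rotation rho.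
Proof.
apply: cvg_lim => //; rewrite -cvg_shiftS.
rewrite (_ : (fun n => _) = (fun n => (1 + T ^+ 2) +
   (series (sin_coeff rho) n.+1 *: T - series (cos_coeff rho) n.+1 *: T ^+ 2))).
  have -> : op_rotation rho = (1 + T ^+ 2) + (sin rho *: T - cos rho *: T ^+ 2).
    by rewrite /op_rotation scalerBl scale1r (addrCA (sin rho *: T)) [LHS]addrA.
  apply: cvgD; first exact: cvg_cst.
  apply: cvgB; apply: cvgZr_tmp.
    rewrite (cvg_shiftS (series (sin_coeff rho))).
    by have := @is_cvg_series_sin_coeff R rho; rewrite unlock.
  rewrite (cvg_shiftS (series (cos_coeff rho))).
  by have := @is_cvg_series_cos_coeff R rho; rewrite unlock.
apply/funext; elim=> [|n IH].
  rewrite !seriesSr /series/= !big_geq// !add0r /exp_term expr0 fact0 invr1 scale1r.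
  rewrite /sin_coeff /cos_coeff/= !mul0r scale0r sub0r expr0 fact0 expr0z.
  by rewrite !mul1r invr1 scale1r addrK.
rewrite seriesSr IH -[X in _ + X = _]/(exp_term (rho *: T) n.+1) exp_term_rotation.
rewrite !(seriesSr _ n.+1) !scalerDl opprD.
by rewrite -addrA; congr (_ + _); rewrite addrACA.
Qed.

(** The inverse is the rotation by [- rho], which is a contraction too. *)
Lemma Iso_rotation : (forall rho z, `|op_rotation rho z| <= `|z|) ->
  forall rho, Iso (op_rotation rho).
Proof.
move=> cT rho; apply: (@Iso_contraction _ _ _ (op_rotation (- rho))) => //.
  exact: op_rotationVK.
by rewrite -{2}[rho]opprK op_rotationVK.
Qed.

End RotationExponential.

(** * Rotations of l2 and their action on the dual *)

Section PlaneRotations.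
Context (R : realType).
Implicit Types (u v : l2 R) (i k n : nat).

Lemma l2P u v : (forall n, u n = v n) -> u = v.
Proof. by move=> uv; apply/val_inj/funext. Qed.

Lemma l2D u v n : (u + v) n = u n + v n. Proof. by []. Qed.
Lemma l2N u n : (- u) n = - u n. Proof. by []. Qed.
Lemma l2Z (a : R) u n : (a *: u) n = a * u n. Proof. by []. Qed.

Lemma l2_basis_subproof i : (fun n => (n == i)%:R : R) \in @l2_pred R.
Proof.
rewrite inE /=; apply/cvg_ex; exists 1; apply: cvg_near_cst.
exists i.+1 => // n /= ni; rewrite /series/= (big_cat_nat (n := i.+1))//=.
rewrite big_nat_recr//= eqxx expr1n big_nat_cond big1 ?add0r.
  rewrite big_nat_cond big1 ?addr0// => m /andP[/andP[im _] _].
  by rewrite gtn_eqF// expr0n.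
by move=> m /andP[/andP[_ mi] _]; rewrite ltn_eqF// expr0n.
Qed.

Definition l2_basis i : l2 R := L2 (l2_basis_subproof i).

Lemma l2_basisE i n : l2_basis i n = (n == i)%:R. Proof. by []. Qed.

Lemma l2_coord_le u n : `|u n| <= `|u|.
Proof.
rewrite -sqrtr_sqr; apply: ler_wsqrtr.
rewrite (le_trans _ (l2_partial_le u n.+1))// seriesSr lerDr.
by rewrite /series/= sumr_ge0// => i _; rewrite sqr_ge0.
Qed.

Lemma l2_norm_eventually u v N :
  (forall n, (N <= n)%N ->
    series (fun i => u i ^+ 2) n = series (fun i => v i ^+ 2) n) ->
  `|u| = `|v|.
Proof.
move=> uv; congr Num.sqrt; apply/esym; apply: cvg_lim => //.
have cu : series (fun i => u i ^+ 2) @ \oo --> l2_sqnorm u by exact: l2_cvg.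
apply: cvg_trans cu; apply: near_eq_cvg.
by exists N => // n /= Nn; rewrite uv.
Qed.

(** Distinct [k] use disjoint coordinate planes, which later separates the generators. *)
Definition plane_rotor_fun k u : l2 R :=
  u k.*2 *: l2_basis k.*2.+1 - u k.*2.+1 *: l2_basis k.*2.

Lemma plane_rotor_linear k : linear (plane_rotor_fun k).
Proof.
move=> a u v; apply: l2P => n; rewrite /plane_rotor_fun.
by rewrite !(l2D, l2N, l2Z, l2_basisE); ring.
Qed.

Lemma plane_rotor_bounded k u : `|plane_rotor_fun k u| <=
  (`|l2_basis k.*2.+1| + `|l2_basis k.*2|) * `|u|.
Proof.
rewrite (le_trans (ler_normB _ _))// !normrZ mulrDl.
by rewrite lerD// mulrC ler_wpM2l// l2_coord_le.
Qed.

Definition plane_rotor k : boundedOp (l2 R) (l2 R) := BoundedOp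
  (bounded_linear_intro (@plane_rotor_linear k) (plane_rotor_bounded k)).

Lemma plane_rotorE k u n : plane_rotor k u n =
  u k.*2 * (n == k.*2.+1)%:R - u k.*2.+1 * (n == k.*2)%:R.
Proof. by []. Qed.

Lemma plane_rotor_even k u : plane_rotor k u k.*2 = - u k.*2.+1.
Proof. by rewrite plane_rotorE eqxx ltn_eqF// mulr0 mulr1 sub0r. Qed.

Lemma plane_rotor_odd k u : plane_rotor k u k.*2.+1 = u k.*2.
Proof. by rewrite plane_rotorE eqxx gtn_eqF// mulr0 mulr1 subr0. Qed.

Lemma plane_rotor_other k u n :
  n != k.*2 -> n != k.*2.+1 -> plane_rotor k u n = 0.
Proof.
by move=> /negbTE n0 /negbTE n1; rewrite plane_rotorE n0 n1 !mulr0 subr0.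
Qed.

Lemma plane_rotor_cube k : plane_rotor k ^+ 3 = - plane_rotor k.
Proof.
apply: opP => u; rewrite exprS expr2 !opM opN; apply: l2P => n; rewrite l2N.
have [->|n0] := eqVneq n k.*2.
  by rewrite !(plane_rotor_even, plane_rotor_odd).
have [->|n1] := eqVneq n k.*2.+1.
  by rewrite !(plane_rotor_even, plane_rotor_odd).
by rewrite !plane_rotor_other// oppr0.
Qed.

Lemma plane_rotation_norm k (rho : R) u :
  `|op_rotation (plane_rotor k) rho u| = `|u|.
Proof.
set v := op_rotation _ _ u.
have vE n : v n = u n + (sin rho * plane_rotor k u n +
    (1 - cos rho) * plane_rotor k (plane_rotor k u) n).
  by rewrite /v op_rotationE expr2 opM !(l2D, l2Z).
have v0 : v k.*2 = cos rho * u k.*2 - sin rho * u k.*2.+1.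
  by rewrite vE !(plane_rotor_even, plane_rotor_odd); ring.
have v1 : v k.*2.+1 = cos rho * u k.*2.+1 + sin rho * u k.*2.
  by rewrite vE !(plane_rotor_even, plane_rotor_odd); ring.
have vo n : n != k.*2 -> n != k.*2.+1 -> v n = u n.
  by move=> n0 n1; rewrite vE !plane_rotor_other// !mulr0 !addr0.
(* The partial sums of squares agree once both coordinates of the rotated plane have been summed. *)
apply: (@l2_norm_eventually _ _ k.*2.+2) => n kn.
rewrite -(subnK kn); elim: (n - _)%N => [|m IH]; last first.
  by rewrite addSn !seriesSr IH vo// ?gtn_eqF// -?addnS ?leq_addl// !addnS;
    rewrite ltnS ?leqW// leq_addl.
rewrite add0n !seriesSr v0 v1 /series/=.
rewrite (_ : \sum_(0 <= i < k.*2) v i ^+ 2 = \sum_(0 <= i < k.*2) u i ^+ 2).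
  have := cos2Dsin2 rho; nra.
by apply: eq_big_nat => i /andP[_ ik]; rewrite vo// ltn_eqF// ltnW.
Qed.

End PlaneRotations.

(** * Generalized limits *)

Definition bounded_seq (R : realType) (a : nat -> R) : Prop :=
  exists M : R, forall n, `|a n| <= M.

(** The limit along an ultrafilter refining the filter at infinity: a bounded sequence takes its
    values in a compact segment, hence converges along it. *)
Lemma generalized_limit (R : realType) : exists L : (nat -> R) -> R,
  [/\ forall k a b, bounded_seq a -> bounded_seq b ->
        L (fun n => k * a n + b n) = k * L a + L b,
      forall a (M : R), (forall n, `|a n| <= M) -> `|L a| <= M &
      forall a l, a @ \oo --> l -> L a = l].
Proof.
have [U [UU leU]] := ultraFilterLemma (eventually_filter : ProperFilter \oo).
have UP : ProperFilter U by exact: ultra_proper.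
have cU a : bounded_seq a -> a @ U --> (lim (a @ U) : R).
  move=> [M aM].
  have UM : U (a @^-1` `[- M, M]%classic).
    by apply: filterE => n; have := aM n; rewrite ler_norml /= in_itv.
  have [l [_ lcl]] := @segment_compact R (- M) M _ (fmap_proper_filter a UP) UM.
  apply/cvg_ex; exists l => V lV.
  have [//|nV] := in_ultra_setVsetC (a @^-1` V) UU.
  by have [x []] := lcl (~` V) V nV lV.
exists (fun a => lim (a @ U)); split=> [k a b ba bb|a M aM|a l al].
- apply: cvg_lim => //; apply: cvgD; last exact: cU.
  by apply: cvgMl_tmp; exact: cU.
- have ba : bounded_seq a by exists M.
  apply: (@closed_cvg _ _ U _ a [set x : R | `|x| <= M] _ _ _ (cU _ ba)).
    have -> : [set x : R | `|x| <= M] = `[- M, M]%classic.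
      by apply/seteqP; split=> x; rewrite /= in_itv/= ler_norml.
    exact: interval_closed.
  by apply: filterE => n; exact: aM.
- apply: cvg_lim => //; apply: cvg_trans al; apply: cvg_app; exact: leU.
Qed.

Lemma op_cvg0 (R : realType) (V W : normedModType R) (T : boundedOp V W)
    (u : nat -> V) : u @ \oo --> 0 -> (fun n => T (u n)) @ \oo --> 0.
Proof.
move=> /cvgr0Pnorm_le u0; apply/cvgr0Pnorm_le => e e0.
have T1 : 0 < `|T| + 1 by rewrite ltr_wpDl.
have := u0 (e / (`|T| + 1)) (divr_gt0 e0 T1); apply: filterS => n un.
rewrite (le_trans (op_le _ _))// (le_trans (ler_wpM2l _ un))//.
by rewrite mulrCA ler_piMr ?(ltW e0)// ler_pdivrMr// mul1r lerDl.
Qed.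

(** * The projection of the dual of X onto the dual of l2, and lifted operators *)

Section DualLift.
Context (R : realType) (j : {linear l2 R -> CDelta R}).
Hypothesis j_isometry : forall u : l2 R, `|j u| = `|u|.
Local Notation X := (Xspace j).
Local Notation X_ext := (X_ext j_isometry).
Implicit Types (f g : X) (mu : dual X) (A B : boundedOp (l2 R) (l2 R)).
Implicit Types (u v : l2 R) (n : nat).

Definition cantor_bump n (t : R) : R := Num.max 0 (1 - n%:R * cantor_dist t).

Lemma cantor_bump_ge0 n t : 0 <= cantor_bump n t.
Proof. by rewrite le_max lexx. Qed.

Lemma cantor_bump_le1 n t : cantor_bump n t <= 1.
Proof. by rewrite ge_max ler01/= gerBl mulr_ge0// cantor_dist_ge0. Qed.

Lemma cantor_bump_continuous n : continuous (cantor_bump n).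
Proof.
apply: continuous_max0 => t; apply: cvgB; first exact: cvg_cst.
by apply: cvgMl_tmp; exact: cantor_dist_continuous.
Qed.

Lemma cantor_bump1 n (d : cantor_set R) :
  (cantor_bump n \o val) (subfun (@cantor_sub R) d) = 1.
Proof.
rewrite /= /cantor_bump cantor_dist_eq0 ?mulr0 ?subr0 ?max_r//.
exact: set_valP.
Qed.

Definition cutoff n f : X :=
  X_mul (continuous_I01 (@cantor_bump_continuous n)) (@cantor_bump1 n) f.

Lemma cutoffE n f x : X_eval (cutoff n f) x = cantor_bump n (val x) * X_eval f x.
Proof. by []. Qed.

Lemma cutoff_trace n f : X_trace (cutoff n f) = X_trace f.
Proof. by rewrite X_trace_mul// scale1r. Qed.

Lemma cutoffL n (k : R) f g : cutoff n (k *: f + g) = k *: cutoff n f + cutoff n g.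
Proof.
apply: X_evalP => x; rewrite cutoffE !X_evalD !X_evalZ !cutoffE; ring.
Qed.

Lemma cutoff_mix_le n f g M : `|f| <= M -> `|g| <= M ->
  `|f - cutoff n f + cutoff n g| <= M.
Proof.
move=> fM gM; apply: X_norm_le => [|x]; first exact: le_trans fM.
rewrite X_evalD X_evalB !cutoffE.
have b0 := cantor_bump_ge0 n (val x); have b1 := cantor_bump_le1 n (val x).
set b := cantor_bump _ _ in b0 b1 *.
have /ler_normlP[f1 f2] := le_trans (X_eval_le f x) fM.
have /ler_normlP[g1 g2] := le_trans (X_eval_le g x) gM.
by rewrite ler_norml; apply/andP; split; nra.
Qed.

Lemma cutoff_le n f : `|cutoff n f| <= `|f|.
Proof.
apply: X_norm_le => // x; rewrite cutoffE normrM.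
rewrite ger0_norm ?cantor_bump_ge0// (le_trans _ (X_eval_le f x))//.
by rewrite ler_piMl// cantor_bump_le1.
Qed.

(** Near a point where [|f| < e], cutting off keeps the values small. Any other point has distance
    [d > 0] to the Cantor set, and the bump vanishes near it once [n >= 2 / d]. Compactness makes
    [n] uniform. *)
Lemma cutoff_cvg0 f : X_trace f = 0 -> (fun n => cutoff n f) @ \oo --> (0 : X).
Proof.
move=> f0; apply/cvgr0Pnorm_le => e e0.
have /compact_near_coveringP cov := compact_set_type (@I01_compact R).
suff : \forall n \near \oo, [set: I01 R] `<=`
    (fun x => `|X_eval (cutoff n f) x| <= e).
  by apply: filterS => n ne; apply: X_norm_le => [|x]; [exact: ltW|exact: ne].
apply: cov => x _; have [xe|xe] := ltP `|X_eval f x| e.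
  exists ([set y | `|X_eval f y| < e], setT) => [|[y n] [/= ye _]].
    split; last exact: filterT.
    exact: (cvgr_lt _ (cvg_norm (@X_eval_continuous R j f x)) _ xe).
  rewrite cutoffE normrM ger0_norm ?cantor_bump_ge0// (le_trans _ (ltW ye))//.
  by rewrite ler_piMl// cantor_bump_le1.
have Cx : ~ cantor_set R (val x).
  move=> Cx; have := X_traceE f (SigSub (mem_set Cx)); rewrite f0 linear0.
  have -> : subfun (@cantor_sub R) (SigSub (mem_set Cx)) = x by exact/val_inj.
  by move=> fx; move: xe; rewrite fx normr0 leNgt e0.
have d0 := cantor_dist_gt0 Cx; set d := cantor_dist _ in d0.
exists ([set y | d / 2 < cantor_dist (val y)], [set n | 2 / d <= n%:R]).
  split; last exact: nbhs_infty_ger.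
  have d2 : d / 2 < d by rewrite ltr_pdivrMr// mulr_natr mulr2n ltrDl.
  exact: (cvgr_gt _ (@continuous_I01 R _ (@cantor_dist_continuous R) x) _ d2).
move=> [y n] [/= yd dn].
rewrite cutoffE /cantor_bump max_l ?mul0r ?normr0 ?(ltW e0)//.
rewrite subr_le0; apply: (@le_trans _ _ (n%:R * (d / 2))); last first.
  by rewrite ler_wpM2l// ltW.
have e1 : (1 : R) = 2 / d * (d / 2) by field; rewrite gt_eqF.
by rewrite [leLHS]e1 ler_wpM2r// divr_ge0// ltW.
Qed.

Variable L : (nat -> R) -> R.
Hypothesis L_linear : forall k a b, bounded_seq a -> bounded_seq b ->
  L (fun n => k * a n + b n) = k * L a + L b.
Hypothesis L_le : forall a (M : R), (forall n, `|a n| <= M) -> `|L a| <= M.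
Hypothesis L_cvg : forall a l, a @ \oo --> l -> L a = l.

(** The projection W: the part of [mu] carried by the Cantor set. *)
Definition singular_part mu f : R := L (fun n => mu (cutoff n f)).

Let cutoff_bounded mu f : forall n, `|mu (cutoff n f)| <= `|mu| * `|f|.
Proof. by move=> n; rewrite (le_trans (op_le _ _))// ler_wpM2l// cutoff_le. Qed.

Let cutoff_bounded_seq mu f : bounded_seq (fun n => mu (cutoff n f)).
Proof. by exists (`|mu| * `|f|); exact: cutoff_bounded. Qed.

Lemma singular_part_linear mu : linear (singular_part mu : X -> R).
Proof.
move=> k f g; rewrite /singular_part.
rewrite -[RHS]/(k * _ + _) -L_linear//; congr L.
by apply/funext => n; rewrite cutoffL linearP.
Qed.

HB.instance Definition _ mu :=
  GRing.isLinear.Build R X R *:%R (singular_part mu) (singular_part_linear mu).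

Lemma singular_partD mu k nu f : singular_part (k *: mu + nu) f =
  k * singular_part mu f + singular_part nu f.
Proof. by rewrite /singular_part -L_linear. Qed.

Lemma singular_part_le mu f : `|singular_part mu f| <= `|mu| * `|f|.
Proof. exact: L_le. Qed.

(** The cutoffs of [f - g] tend to 0 in norm, and [L] extends the ordinary limit. This is what makes
    the nonlinear choice [X_ext] harmless in [lift_fun]. *)
Lemma singular_part_trace mu f g :
  X_trace f = X_trace g -> singular_part mu f = singular_part mu g.
Proof.
move=> fg; apply/eqP; rewrite -subr_eq0.
have -> : singular_part mu f - singular_part mu g = singular_part mu (f - g).
  have := singular_part_linear mu (-1) g f.
  by rewrite !scaleN1r (addrC (- g)) => ->; exact: addrC.
apply/eqP; apply: L_cvg; apply: op_cvg0; apply: cutoff_cvg0.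
by rewrite linearB/= fg subrr.
Qed.

Definition lift_fun A mu f : R := singular_part mu (X_ext (A (X_trace f))).

Lemma lift_fun_linear A mu : linear (lift_fun A mu : X -> R).
Proof.
move=> k f g; rewrite /lift_fun -singular_part_linear.
by apply: singular_part_trace; rewrite X_extK !linearP /= !X_extK.
Qed.

Lemma lift_fun_le A mu f : `|lift_fun A mu f| <= `|mu| * `|A| * `|f|.
Proof.
rewrite (le_trans (singular_part_le _ _))// -mulrA ler_wpM2l//.
rewrite (le_trans (X_ext_le _ _))// (le_trans (op_le _ _))// ler_wpM2l//.
exact: X_trace_le.
Qed.

Definition lift_functional A mu : dual X :=
  BoundedOp (bounded_linear_intro (lift_fun_linear A mu) (lift_fun_le A mu)).

Lemma lift_functionalE A mu f :
  lift_functional A mu f = singular_part mu (X_ext (A (X_trace f))).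
Proof. by []. Qed.

Lemma lift_functional_linear A : linear (lift_functional A).
Proof.
move=> k mu nu; apply: opP => f; rewrite lift_functionalE singular_partD.
by rewrite opD opZ !lift_functionalE.
Qed.

Lemma lift_functional_le A mu : `|lift_functional A mu| <= `|A| * `|mu|.
Proof.
apply: op_norm_le => [|f]; first by rewrite mulr_ge0.
by rewrite (mulrC `|A|) lift_fun_le.
Qed.

Definition dual_lift A : boundedOp (dual X) (dual X) := BoundedOp
  (bounded_linear_intro (lift_functional_linear A) (lift_functional_le A)).

Lemma dual_liftE A mu f :
  dual_lift A mu f = singular_part mu (X_ext (A (X_trace f))).
Proof. by []. Qed.

Lemma dual_liftN A : dual_lift (- A) = - dual_lift A.
Proof.
apply: opP => mu; apply: opP => f; rewrite opN [RHS]opN !dual_liftE opN.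
rewrite -[RHS]linearN; apply: singular_part_trace.
by rewrite X_extK linearN/= X_extK.
Qed.

(** The order is reversed because lifting acts as an adjoint. The sequence under the outer [L] is
    constant, since cutting off preserves the trace. *)
Lemma dual_liftM A B : dual_lift A * dual_lift B = dual_lift (B * A).
Proof.
apply: opP => mu; apply: opP => f; rewrite opM !dual_liftE opM.
apply: L_cvg; apply: cvg_near_cst; apply: filterE => n.
by rewrite dual_liftE; apply: singular_part_trace; rewrite cutoff_trace !X_extK.
Qed.

Lemma dual_lift_contraction A mu (s c : R) :
  (forall u, `|u + (s *: A u + c *: (A * A) u)| <= `|u|) ->
  `|mu + (s *: dual_lift A mu + c *: (dual_lift A * dual_lift A) mu)| <= `|mu|.
Proof.
move=> cA; apply: op_norm_le => // f.
rewrite dual_liftM !opD !opZ !dual_liftE.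
set u := X_trace f; set v := u + (s *: A u + c *: (A * A) u).
(* Both sides evaluate W mu at functions with the same trace [v - u]. *)
have -> : s *: singular_part mu (X_ext (A u)) +
    c *: singular_part mu (X_ext ((A * A) u)) =
    singular_part mu (X_ext v) - singular_part mu f.
  rewrite -!linearZ -linearD -linearB; apply: singular_part_trace.
  by rewrite !(linearD, linearN, linearZ)/= !X_extK /v addrAC subrr add0r.
(* Writing the number [mu f] as the limit of a constant sequence merges all terms into one limit of
   [mu] on convex mixtures of [f] and [X_ext v]. *)
have -> : mu f + (singular_part mu (X_ext v) - singular_part mu f) =
    L (fun n => mu (f - cutoff n f + cutoff n (X_ext v))).
  have bf : bounded_seq (fun=> mu f) by exists `|mu f|.
  have -> : mu f = L (fun=> mu f) by apply/esym; apply: L_cvg; exact: cvg_cst.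
  rewrite -linearB addrC -[X in X + _ = _]mul1r -L_linear//; congr L.
  apply/funext => n; rewrite mul1r (addrC (X_ext v)) -[- f]scaleN1r cutoffL scaleN1r.
  by rewrite addrC -linearD addrA.
apply: L_le => n; rewrite (le_trans (op_le _ _))// ler_wpM2l//.
rewrite cutoff_mix_le// (le_trans (X_ext_le _ _))// (le_trans (cA _))//.
exact: X_trace_le.
Qed.

End DualLift.

(** * Infinite dimension and independent generators on the dual *)

Lemma kermx_relation (R : fieldType) n (C : 'M[R]_(n.+1, n)) :
  exists2 u : 'rV[R]_n.+1, u != 0 & u *m C = 0.
Proof.
have : kermx C != 0.
  rewrite kermx_eq0 /row_free neq_ltn; apply/orP; left.
  by rewrite ltnS rank_leq_col.
by move=> /rowV0Pn[u /sub_kermxP uC u0]; exists u.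
Qed.

(** If [n] vectors spanned, then [n.+1] of the [t k] would satisfy a nontrivial relation, and
    applying [phi l] to it kills its [l]-th coefficient. *)
Lemma infinite_dimensional_biorthogonal (R : realType) (V : lmodType R)
    (S : set V) (t : nat -> V) (phi : nat -> V -> R) :
  submod_closed (mem S) -> (forall k, S (t k)) ->
  (forall k (a : R) x y, phi k (a *: x + y) = a * phi k x + phi k y) ->
  (forall k l, phi l (t k) = - (k == l)%:R) ->
  infinite_dimensional S.
Proof.
move=> subS St phiL phit; split=> // n v Sv.
have phi0 l : phi l 0 = 0.
  by have := phiL l (-1) 0 0; rewrite scaler0 addr0 mulN1r addNr.
have phi_sum l m (c : 'I_m -> R) (w : 'I_m -> V) :
    phi l (\sum_(i < m) c i *: w i) = \sum_(i < m) c i * phi l (w i).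
  elim: m c w => [|m IH] c w; first by rewrite !big_ord0 phi0.
  by rewrite !big_ord_recl phiL IH.
have /choice[c tc] : forall k : 'I_n.+1,
    exists c : 'I_n -> R, t k = \sum_(i < n) c i *: v i.
  by move=> k; exact: Sv (St k).
have [u u0 uC] := kermx_relation (\matrix_(k, i) c k i).
move/eqP: u0; apply; apply/rowP => l; rewrite mxE.
have : phi l (\sum_(k < n.+1) u 0 k *: t k) = 0.
  have -> : \sum_(k < n.+1) u 0 k *: t k = 0.
    under eq_bigr do rewrite tc scaler_sumr.
    rewrite exchange_big big1// => i _.
    under eq_bigr do rewrite scalerA.
    rewrite -scaler_suml; move/rowP/(_ i): uC; rewrite !mxE.
    by under eq_bigr do rewrite mxE; move=> ->; rewrite scale0r.
  exact: phi0.
rewrite phi_sum (bigD1 l)//= phit eqxx big1 ?addr0 ?mulrN1.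
  by move=> /eqP; rewrite oppr_eq0 => /eqP.
move=> k kl; rewrite phit (_ : (nat_of_ord k == l) = false) ?oppr0 ?mulr0//.
by apply/negbTE.
Qed.

Section DualRotors.
Context (R : realType) (j : {linear l2 R -> CDelta R}).
Hypothesis j_isometry : forall u : l2 R, `|j u| = `|u|.
Local Notation X := (Xspace j).

Definition coord_fun i (f : X) : R := X_trace f i.

Lemma coord_fun_linear i : linear (coord_fun i : X -> R).
Proof. by move=> k f g; rewrite /coord_fun (X_trace_linear j_isometry). Qed.

Lemma coord_fun_le i f : `|coord_fun i f| <= 1 * `|f|.
Proof.
by rewrite mul1r (le_trans (l2_coord_le _ _))// (X_trace_le j_isometry).
Qed.

Definition coord_functional i : dual X :=
  BoundedOp (bounded_linear_intro (coord_fun_linear i) (coord_fun_le i)).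

Lemma coord_functionalE i f : coord_functional i f = X_trace f i.
Proof. by []. Qed.

(* [T l] is a rotation generator on the l-th coordinate plane of the summand
   E^* of X(E)^* ; the pair [mu k], [f k] reads off one of its entries. *)
Lemma dual_rotors : exists (T : nat -> boundedOp (dual X) (dual X))
    (mu : nat -> dual X) (f : nat -> X),
  [/\ forall k, T k ^+ 3 = - T k,
      forall k rho, Iso (op_rotation (T k) rho) &
      forall k l, [/\ mu k (f k) = 0, T l (mu k) (f k) = - (l == k)%:R &
        (T l ^+ 2) (mu k) (f k) = 0]].
Proof.
have [L [L_linear L_le L_cvg]] := generalized_limit R.
pose lift := dual_lift j_isometry L_linear L_le L_cvg.
have T3 k : lift (plane_rotor R k) ^+ 3 = - lift (plane_rotor R k).
  rewrite exprS expr2 !dual_liftM -dual_liftN -plane_rotor_cube.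
  by rewrite exprSr expr2.
(* An off-diagonal entry is read: functional of coordinate [2k], extension of the basis vector
   [2k + 1]. There the identity and the squares of the generators contribute 0. *)
exists (fun k => lift (plane_rotor R k)), (fun k => coord_functional k.*2),
  (fun k => X_ext j_isometry (l2_basis R k.*2.+1)).
split=> // [k rho|k l].
  apply: Iso_rotation => // {}rho mu.
  rewrite op_rotationE expr2.
  apply: dual_lift_contraction => u.
  by have := plane_rotation_norm k rho u; rewrite op_rotationE expr2 => ->.
cbv beta.
have liftE A i g : lift A (coord_functional i) g = A (X_trace g) i.
  rewrite dual_liftE; apply: (L_cvg _ _); apply: cvg_near_cst; apply: filterE => n.
  by rewrite coord_functionalE (cutoff_trace j_isometry) X_extK.
have kl2 (a b : nat) : (a.*2.+1 == b.*2) = false.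
  by apply/negP => /eqP/(congr1 odd); rewrite /= !odd_double.
split.
- by rewrite coord_functionalE X_extK l2_basisE eq_sym kl2.
- rewrite liftE X_extK plane_rotorE !l2_basisE eqSS eq_sym kl2 mul0r sub0r.
  rewrite -!mul2n !eqn_pmul2l// (eq_sym k).
  by case: eqP => _; rewrite ?mulr1 ?mulr0.
rewrite expr2 dual_liftM liftE opM X_extK plane_rotorE plane_rotor_odd.
rewrite l2_basisE (eq_sym k.*2 l.*2.+1) kl2 (eq_sym l.*2 k.*2.+1) kl2.
by rewrite mulr0 mul0r subrr.
Qed.

End DualRotors.

Unset Implicit Arguments.

Theorem mainTheorem1 (R : realType) (j : {linear l2 R -> CDelta R})
    (j_isometry : forall u : l2 R, `|j u| = `|u|) :
  (forall T : boundedOp (Xspace j) (Xspace j),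
      one_parameter_group T `<=` @Iso R (Xspace j) -> T = 0) /\
  infinite_set (@one_parameter_subgroups R (dual (Xspace j))) /\
  @tangent_Iso R (Xspace j) = [set 0] /\
  infinite_dimensional (@tangent_Iso R (dual (Xspace j))).
Proof.
have [T [mu [f [T3 TI Tmu]]]] := dual_rotors j_isometry.
have mu0 : mu 0%N != 0.
  apply/eqP => m0; have [_ + _] := Tmu 0%N 0%N.
  by rewrite m0 linear0 => /esym/eqP; rewrite oppr_eq0 oner_eq0.
have f0 : f 0%N != 0.
  apply/eqP => f0; have [_ + _] := Tmu 0%N 0%N.
  by rewrite f0 linear0 => /esym/eqP; rewrite oppr_eq0 oner_eq0.
have GI k : one_parameter_group (T k) `<=` @Iso R (dual (Xspace j)).
  by move=> _ [rho _ <-]; rewrite (op_exp_rotation (T3 k)).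
(* The chosen entry of a rotation sees only the sine term. *)
have rotE k l rho :
    op_rotation (T l) rho (mu k) (f k) = - (sin rho * (l == k)%:R).
  have [m0 T1 T2] := Tmu k l.
  by rewrite op_rotationE 2!opD !opZ m0 T1 T2 scaler0 addr0 add0r [LHS]mulrN.
split=> [S SI|].
  apply: tangent_Iso_Xspace_eq0.
  by apply: tangent_one_parameter_group => //; exists (f 0%N).
split.
  apply/infiniteP/pcard_leP/injfunPex => /=.
  (* Distinct indices give distinct groups: at angle [pi / 2] the [k]-th entry is -1 in the [k]-th
     group, but it is 0 throughout the [l]-th group for [l != k]. *)
  exists (fun k => one_parameter_group (T k)) => [k _|k l _ _ Gkl].
    by split; [exact: GI|exists (T k)].
  have : one_parameter_group (T l) (op_exp ((pi / 2) *: T k)).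
    by rewrite -Gkl; exists (pi / 2).
  move=> [rho _]; rewrite !(op_exp_rotation (T3 _)) => kl.
  have := congr1 (fun S : boundedOp (dual _) (dual _) => S (mu k) (f k)) kl.
  rewrite !rotE sin_pihalf eqxx mul1r; case: eqP => // _.
  by rewrite mulr0 oppr0 => /eqP; rewrite eq_sym oppr_eq0 oner_eq0.
split.
  apply/seteqP; split=> [S /tangent_Iso_Xspace_eq0//|_ ->].
  by have [+ _] := tangent_Iso_submod (Xspace j); rewrite inE.
apply: (@infinite_dimensional_biorthogonal R _ _ T
  (fun k (S : boundedOp (dual _) (dual _)) => S (mu k) (f k))).
- exact: tangent_Iso_submod.
- by move=> k; apply: tangent_one_parameter_group (GI k); exists (mu 0%N).
- by move=> k a S S'; rewrite opD opZ.
- by move=> k l; have [] := Tmu l k.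
Qed.
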